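(* Let $\eta\in(1,\infty)$, let $(q,p)\in\mathcal{CH}$, let $\varkappa$ be a cardinal, and let $G\in\mathcal{G}$ be divisible. Put $R=\{\eta^{-g}\mid g\in G\sqcup\{\infty\}\}$. Let $(K,v)$ be a valued field of characteristic $q$ such that $v(K)\subseteq G\sqcup\{\infty\}$ and the residue class field of $(K,v)$ has characteristic $p$. Assume moreover that, if $q\neq p$, then $v(p)=1$. Then there exists a valued field $(L,w)$ such that: (L1) $(L,w)$ is a valued field extension of $(K,v)$; (L2) $w(L)=G\sqcup\{\infty\}$; (L3) for each $R$-valued ultrametric space $(X,d)$ with either $X=\emptyset$ or $\mathrm{Card}(X\sqcup\{\ast\})\le\varkappa$ for some $\ast\notin X$, there exists an isometric embedding $I\colon(X,d)\to(L,\|\cdot\|_{w,\eta})$ such that the set $I(X)$ is algebraically independent over $K$. Moreover, for every $R$-valued ultrametric space $(X,d)$ there exist a valued field $(F,u)$ and a map $I\colon X\to F$ such that: (F1) $I\colon(X,d)\to(F,\|\cdot\|_{u,\eta})$ is an isometric embedding; (F2) $(F,u)$ is a valued field extension of $(K,v)$; (F3) $u(F)\subseteq G\sqcup\{\infty\}$; (F4) the set $I(X)$ is closed in $F$; (F5) the set $I(X)$ is algebraically independent over $K$; (F6) if $(X,d)$ is complete, then $(F,u)$ can be chosen to be complete.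
   Context: A valued field $(K,v)$ is a field $K$ with a map $v\colon K\to\mathbb{R}\sqcup\{\infty\}$ such that $v(x)=\infty$ iff $x=0$, $v(xy)=v(x)+v(y)$, and $v(x+y)\ge\min\{v(x),v(y)\}$. Its residue class field is $\{v\ge0\}/\{v>0\}$. $(L,w)$ is a valued field extension of $(K,v)$ if $K\subseteq L$ is a subfield and $w|_K=v$. For $\eta\in(1,\infty)$, put $\|x\|_{v,\eta}=\eta^{-v(x)}$ with $\eta^{-\infty}=0$; the field is regarded as a metric space with distance $\|x-y\|_{v,\eta}$, and closedness and completeness refer to this metric. $\mathcal{G}$ is the set of all subgroups $G$ of $(\mathbb{R},+)$ with $1\in G$. $G$ is divisible if for every $g\in G$ and every integer $n\ge1$ there is $h\in G$ with $g=nh$. $\mathcal{CH}$ is the set of pairs $(q,p)$, where each of $q,p$ is $0$ or a prime, such that either $q=p$, or $q=0$ and $p>0$. An ultrametric on $X$ is a metric $d$ with $d(x,y)\le\max\{d(x,z),d(z,y)\}$ for all $x,y,z$; it is $R$-valued if $d(x,y)\in R$ for all $x,y$. A subset $S$ of an extension field of $K$ is algebraically independent over $K$ if no finite collection of distinct elements of $S$ satisfies a non-trivial polynomial equation with coefficients in $K$. *)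

(* Defs.v *)
From HB Require Import structures.
From mathcomp Require Import all_boot all_order all_algebra.
From mathcomp Require Import ring_quotient.
From mathcomp Require Import all_classical all_reals all_analysis.
(* The notations of mpoly clash with those of the analysis library. *)
From mathcomp Require mpoly.
Import (canonicals) mpoly.

Set Implicit Arguments.
Unset Strict Implicit.
Unset Printing Implicit Defensive.

Import Order.TTheory GRing.Theory Num.Theory.

Local Open Scope classical_set_scope.
Local Open Scope ring_scope.
Local Open Scope quotient_scope.

(* The codomain ℝ ⊔ {∞} is \bar R with -oo excluded. *)
Record valuation (R : realType) (K : fieldType) := Valuation {
  valuation_fun :> K -> \bar R ;
  valuation_gtNye : forall x, valuation_fun x != -oo%E ;
  valuation_eqy : forall x, valuation_fun x = +oo%E <-> x = 0 ;
  valuationM : forall x y,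
    valuation_fun (x * y) = (valuation_fun x + valuation_fun y)%E ;
  valuationD : forall x y,
    (Order.min (valuation_fun x) (valuation_fun y)
       <= valuation_fun (x + y))%E }.

Section valuation_theory.
Context {R : realType} {K : fieldType} (v : valuation R K).
Implicit Types x y : K.

Lemma valuation0 : v 0 = +oo%E. Proof. exact/valuation_eqy. Qed.

Lemma valuation_fin x : x != 0 -> exists r : R, v x = r%:E.
Proof.
move=> x0; case E : (v x) => [r| |]; first by exists r.
- by move/valuation_eqy: E x0 => ->; rewrite eqxx.
- by have := valuation_gtNye v x; rewrite E eqxx.
Qed.

Lemma valuation1 : v 1 = 0%E.
Proof.
have [r E] := valuation_fin (oner_neq0 K).
have := valuationM v 1 1; rewrite mulr1 E -EFinD => -[] /eqP.
by rewrite -subr_eq0 opprD addrA subrr add0r oppr_eq0 => /eqP ->.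
Qed.

Lemma valuationN x : v (- x) = v x.
Proof.
have N0 : (-1 : K) != 0 by rewrite oppr_eq0 oner_neq0.
have [r E] := valuation_fin N0.
have := valuationM v (-1) (-1); rewrite mulrNN mulr1 valuation1 E -EFinD => -[].
move=> /esym/eqP; rewrite -mulr2n mulrn_eq0/= => /eqP r0.
by rewrite -mulN1r valuationM E r0 add0e.
Qed.

Lemma valuationV x : x != 0 -> v x = 0%E -> v x^-1 = 0%E.
Proof.
move=> x0 vx; have := valuationM v x x^-1.
by rewrite divff// valuation1 vx add0e.
Qed.

End valuation_theory.

Section residue_class_field.
Context {R : realType} {K : fieldType} (v : valuation R K).

Definition valuation_ring_pred : {pred K} := fun x => (0 <= v x)%E.

Lemma valuation_ring_pred_closed : subring_closed valuation_ring_pred.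
Proof.
split; rewrite ?unfold_in /=.
- by rewrite valuation1.
- move=> x y; rewrite !unfold_in => x0 y0; apply: le_trans (valuationD v _ _).
  by rewrite le_min x0 valuationN.
- by move=> x y; rewrite !unfold_in valuationM => x0 y0; exact: adde_ge0.
Qed.

HB.instance Definition _ := GRing.isSubringClosed.Build K valuation_ring_pred
  valuation_ring_pred_closed.

Record valuation_ring := ValuationRing {
  valuation_ring_val :> K ;
  valuation_ringP : valuation_ring_val \in valuation_ring_pred }.

HB.instance Definition _ := [isSub for valuation_ring_val].
HB.instance Definition _ := [Choice of valuation_ring by <:].
HB.instance Definition _ :=
  [SubChoice_isSubComNzRing of valuation_ring by <:].

Definition maximal_ideal : {pred valuation_ring} :=
  fun x => (0 < v (val x))%E.

Lemma maximal_ideal_closed : idealr_closed maximal_ideal.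
Proof.
split; rewrite ?unfold_in/=.
- by rewrite valuation0.
- by rewrite valuation1 ltxx.
- move=> a x y; rewrite !unfold_in/= => x0 y0.
  apply: lt_le_trans (valuationD v _ _); rewrite lt_min y0 andbT valuationM.
  by rewrite lte_spaddre//; case: a => a /=; rewrite unfold_in.
Qed.

HB.instance Definition _ := isIdealr.Build valuation_ring maximal_ideal
  maximal_ideal_closed.

Definition residue_field := {ideal_quot maximal_ideal}.

HB.instance Definition _ := GRing.ComNzRing.on residue_field.

Let pi_eq0 (a : valuation_ring) :
  (\pi_residue_field a == 0 :> residue_field) = (a \in maximal_ideal).
Proof.
have <- : \pi_residue_field 0 = 0 :> residue_field by exact: rmorph0.
by rewrite -(Quotient.idealrBE maximal_ideal) subr0.
Qed.

Definition residue_inv (x : residue_field) : residue_field :=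
  \pi_residue_field (insubd (0 : valuation_ring) (val (repr x))^-1).

Fact residue_mulVf (x : residue_field) : x != 0 -> residue_inv x * x = 1.
Proof.
rewrite -[in X in X -> _](reprK x) pi_eq0 unfold_in -leNgt => vx_le0.
have vx : v (val (repr x)) = 0%E.
  by apply/eqP; rewrite eq_le vx_le0; exact: (valP (repr x)).
have x0 : val (repr x) != 0.
  by apply/eqP => x0; move: vx; rewrite x0 valuation0.
rewrite -[X in _ * X](reprK x) /residue_inv -rmorphM.
rewrite (_ : _ * _ = 1) ?rmorph1//; apply/val_inj => /=.
rewrite insubdK ?mulVf//.
by change (0 <= v ((val (repr x))^-1)%R)%E; rewrite valuationV.
Qed.

Fact residue_inv0 : residue_inv 0 = 0.
Proof.
apply/eqP; rewrite pi_eq0.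
set y := repr _; have : y \in maximal_ideal by rewrite -pi_eq0 reprK.
rewrite unfold_in => vy.
set z := insubd _ _; change (0 < v (val z))%E; rewrite {}/z val_insubd.
case: ifPn => [vVy_ge0|_]; last by rewrite /= valuation0.
have [->|y0] := eqVneq (val y) 0; first by rewrite invr0 valuation0.
have := valuation1 v; rewrite -(mulfV y0) valuationM => /eqP.
by rewrite gt_eqF// addeC lte_spaddre.
Qed.

HB.instance Definition _ :=
  GRing.ComNzRing_isField.Build residue_field residue_mulVf residue_inv0.

End residue_class_field.

Section valued_metric.
Context {R : realType}.

(* eta ^ (- a) for a in ℝ ⊔ {∞}, with eta ^ (- ∞) = 0 *)
Definition expeN (eta : R) (a : \bar R) : R :=
  if a is r%:E then eta `^ (- r) else 0.

Definition vnorm (K : fieldType) (v : valuation R K) (eta : R) (x : K) : R :=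
  expeN eta (v x).

(* A copy of K carrying the distance vnorm v eta (x - y); the argument eta_gt1
   only serves to infer the metric instance. *)
Definition vmetric (K : fieldType) (v : valuation R K) (eta : R)
  (eta_gt1 : 1 < eta) : Type := K.

Context (K : fieldType) (v : valuation R K) (eta : R) (eta_gt1 : 1 < eta).
Local Notation M := (@vmetric K v eta eta_gt1).

HB.instance Definition _ := Choice.copy M K.

Definition vdist (x y : M) : R := vnorm v eta ((x : K) - (y : K)).

Lemma expeN_ge0 (a : \bar R) : 0 <= expeN eta a.
Proof. by case: a => //= r; exact: powR_ge0. Qed.

Lemma expeN_anti (a b : \bar R) : a != -oo%E -> (a <= b)%E ->
  expeN eta b <= expeN eta a.
Proof.
case: a => [r| |]//; case: b => [s| |]//= _; rewrite ?powR_ge0//.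
by rewrite lee_fin => rs; apply: ler_powR; [exact: ltW|rewrite lerN2].
Qed.

Fact vdistxx (x : M) : vdist x x = 0.
Proof. by rewrite /vdist /vnorm subrr valuation0. Qed.

Fact vdist_positivity (x y : M) : vdist x y = 0 -> x = y.
Proof.
rewrite /vdist /vnorm => xy; apply/eqP; rewrite -(subr_eq0 (x : K)).
apply/negPn/negP => /(valuation_fin v)[r E]; move: xy; rewrite E /= => /eqP.
by rewrite gt_eqF// powR_gt0// (lt_trans _ eta_gt1).
Qed.

Fact vdist_sym (x y : M) : vdist x y = vdist y x.
Proof. by rewrite /vdist /vnorm -valuationN opprB. Qed.

Fact vdist_triangle (y x z : M) : vdist x z <= vdist x y + vdist y z.
Proof.
rewrite /vdist /vnorm.
have -> : (x : K) - (z : K) = ((x : K) - (y : K)) + ((y : K) - (z : K)).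
  by rewrite addrA subrK.
set a := (x : K) - _; set b := (y : K) - _.
have := valuationD v a b; rewrite ge_min => /orP[] /expeN_anti le.
- by rewrite (le_trans (le (valuation_gtNye v a)))// lerDl expeN_ge0.
- by rewrite (le_trans (le (valuation_gtNye v b)))// lerDr expeN_ge0.
Qed.

HB.instance Definition _ :=
  @isMetric.Build R M vdist vdistxx vdist_positivity vdist_sym vdist_triangle.

End valued_metric.

Section metric_notions.
Context {R : realType}.

Definition ultrametric (X : metricType R) : Prop :=
  forall x y z : X, mdist x y <= Num.max (mdist x z) (mdist z y).

Definition metric_valued_in (S : set R) (X : metricType R) : Prop :=
  forall x y : X, S (mdist x y).

Definition isometric_embedding (X Y : metricType R) (f : X -> Y) : Prop :=
  forall x y : X, mdist (f x) (f y) = mdist x y.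

End metric_notions.

(* This is the axiom of the library's [completeType], which is not used because
   it bundles a point whereas the spaces considered here may be empty. *)
Definition complete_space (T : uniformType) : Prop :=
  forall F : set_system T, ProperFilter F -> cauchy F -> exists l : T, F --> l.

Definition group_divisible (V : zmodType) (G : {pred V}) : Prop :=
  forall g, g \in G -> forall n, (0 < n)%N -> exists2 h, h \in G & g = h *+ n.

Definition adjoin_infty (R : realType) (G : {pred R}) : set (\bar R) :=
  [set g%:E | g in [set` G]] `|` [set +oo%E].

Definition has_char (F : nzRingType) (q : nat) : Prop :=
  if q is 0%N then [pchar F] =i pred0 else q \in [pchar F].

Definition CH (q p : nat) : Prop :=
  [/\ q = 0%N \/ prime q, p = 0%N \/ prime p
    & q = p \/ (q = 0%N /\ (0 < p)%N)].

(* The inclusion of the subfield K in L is the field morphism iota. *)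
Definition valued_extension (R : realType) (K L : fieldType)
    (v : valuation R K) (w : valuation R L) (iota : {rmorphism K -> L}) :=
  forall x, w (iota x) = v x.

Definition algebraically_independent (K L : fieldType)
    (iota : {rmorphism K -> L}) (S : set L) : Prop :=
  forall (n : nat) (x : 'I_n -> L), injective x -> (forall i, S (x i)) ->
  forall P : mpoly.mpoly n K, mpoly.mmap iota x P = 0 -> P = 0.

(* Main.v *)
From HB Require Import structures.
Require Import Defs.
From mathcomp Require Import all_boot all_order all_algebra.
From mathcomp Require Import generic_quotient ring_quotient.
From mathcomp Require Import all_classical all_reals all_analysis.
From mathcomp Require mpoly.
Import (canonicals, coercions) mpoly.

(* To adjoin finitely many points of an ultrametric space one after the other,
   put T_x = T_j + S, where j is a nearest point among the previous ones and 0,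
   and S is transcendental with the Gauss valuation such that
   w(S) = - log d(x, j). The resulting valuation on K[T_a : a in A] is the least
   one among the valuations w extending v with w(T_a - T_b) >= - log d(a, b):
   hence it does not depend on the order of the points, it is compatible with
   enlarging A, and the fields obtained from the finite subsets glue to a valued
   field F_0 generated over K by algebraically independent elements T_x, with
   values in G. An element f of F_0 other than the T_x involves finitely many
   points A, and f - T_x is never closer to 0 than the closest f - T_a with a
   in A; so the T_x form a closed set. If X is complete, the completion of F_0
   works. Finally, all the small ultrametric spaces embed into a single one, a
   disjoint union indexed by the ultrametrics on a fixed set, whence L. *)

Set Implicit Arguments.
Unset Strict Implicit.
Unset Printing Implicit Defensive.

Import Order.TTheory GRing.Theory Num.Theory.

Local Open Scope classical_set_scope.
Local Open Scope card_scope.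
Local Open Scope ring_scope.

(** * Gauss extensions *)

Section valuation_extra.
Context {R : realType} {K : fieldType} (v : valuation R K).
Implicit Types x y : K.

(** The obstacle is the gluing. The field attached to a finite set of points depends on the order of
    adjunction and on the chosen nearest points, so no canonical maps link these fields and there is
    no ready direct system whose union could be taken. Minimality replaces the maps: it fixes the
    value of every formal rational expression in the points, whichever field the expression is
    evaluated in. An element of F_0 is therefore a class of expressions, two of them being
    identified when their difference has value infinity. The field laws and the valuation are then
    checked in one finite extension at a time, large enough for the expressions at hand.

    The element 0 belongs to every extension, so its distance to each T_x has to be prescribed as
    well. This is done with an auxiliary base point o, foreign to the given space and sent to 0,
    which is left out of the embedding because 0 is never algebraically independent. *)

Lemma valuation_lt_sum (I : Type) (r : seq I) (P : pred I) (F : I -> K) a :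
  (a < +oo)%E -> (forall i, P i -> (a < v (F i))%E) ->
  (a < v (\sum_(i <- r | P i) F i)%R)%E.
Proof.
move=> ay aF; elim/big_ind : _ => [|x y ax ay'|//]; first by rewrite valuation0.
by apply: lt_le_trans (valuationD v _ _); rewrite lt_min ax.
Qed.

Lemma valuation_le_sum (I : Type) (r : seq I) (P : pred I) (F : I -> K) a :
  (forall i, P i -> (a <= v (F i))%E) -> (a <= v (\sum_(i <- r | P i) F i)%R)%E.
Proof.
move=> aF; elim/big_ind : _ => [|x y ax ay'|//].
  by rewrite valuation0 leey.
by apply: le_trans (valuationD v _ _); rewrite le_min ax.
Qed.

Lemma valuationB x y : (Order.min (v x) (v y) <= v (x - y)%R)%E.
Proof. by rewrite -(valuationN v y); exact: valuationD. Qed.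

Lemma valuation_distC x y : v (x - y) = v (y - x).
Proof. by rewrite -valuationN opprB. Qed.

Lemma valuationDl x y : (v x < v y)%E -> v (x + y) = v x.
Proof.
move=> xy; apply/eqP; rewrite eq_le; apply/andP; split; last first.
  by apply: le_trans (valuationD v _ _); rewrite le_min lexx ltW.
rewrite leNgt; apply/negP => lt.
have := valuationB (x + y) y; rewrite addrK leNgt => /negP; apply.
by rewrite lt_min lt.
Qed.

Lemma valuationX_ge x (g : R) n :
  (g%:E <= v x)%E -> ((g *+ n)%R%:E <= v (x ^+ n)%R)%E.
Proof.
move=> gx; elim: n => [|n IH]; first by rewrite valuation1.
by rewrite exprS mulrS valuationM EFinD leeD.
Qed.

Lemma valuation_inv x : x != 0 -> v x^-1 = (- v x)%E.
Proof.
move=> x0; have := valuationM v x x^-1; rewrite divff// valuation1.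
have [r ->] := valuation_fin v x0.
have [s ->] := valuation_fin v (invr_neq0 x0).
rewrite -EFinD -EFinN => -[] /esym/eqP.
by rewrite addr_eq0 => /eqP ->; rewrite opprK.
Qed.

Lemma valuation_div x y : y != 0 -> v (x / y) = (v x - v y)%E.
Proof. by move=> y0; rewrite valuationM valuation_inv. Qed.

End valuation_extra.

Local Notation "x %:F" := (@FracField.tofrac _ x).

Lemma fractionP (D : idomainType) (z : {fraction D}) :
  exists x y : D, y != 0 /\ z = x%:F / y%:F.
Proof.
elim/quotW : z => r; exists (fraction.frac r).1, (fraction.frac r).2.
split; first exact: denom_ratioP.
rewrite -[in LHS](Ratio_numden r); unlock FracField.tofrac.
rewrite -[X in _ = _ * X]FracField.pi_inv -[RHS]FracField.pi_mul.
rewrite /FracField.mulf /FracField.invf.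
by rewrite !(numden_Ratio, mul1r, mulr1) ?oner_neq0 ?denom_ratioP.
Qed.

(** * Extending a valuation from a domain to its field of fractions *)

Section fraction_valuation.
Context {R : realType} {D : idomainType} (v : D -> \bar R).
Hypothesis v_Ny : forall x, v x != -oo%E.
Hypothesis v_y : forall x, v x = +oo%E <-> x = 0.
Hypothesis vM : forall x y, v (x * y)%R = (v x + v y)%E.
Hypothesis vD : forall x y, (Order.min (v x) (v y) <= v (x + y)%R)%E.

Let v_fin x : x != 0 -> v x \is a fin_num.
Proof.
move=> x0; rewrite fin_numE v_Ny/=; apply/eqP => /v_y/eqP.
by rewrite (negbTE x0).
Qed.

Definition frac_val (z : {fraction D}) : \bar R :=
  (v (sval (cid (fractionP z))) - v (sval (cid (svalP (cid (fractionP z))))))%E.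

(** [frac_val] reads an arbitrary presentation as a quotient; cross-multiplying two presentations
    and applying [vM] shows that the result does not depend on it. Nonzero denominators have finite
    values, which keeps the subtraction in [\bar R] meaningful. *)
Lemma frac_val_div x y : y != 0 -> frac_val (x%:F / y%:F) = (v x - v y)%E.
Proof.
move=> y0; rewrite /frac_val; case: cid => a /= h; case: cid => b /= [b0].
have t0 c : c != 0 -> c%:F != 0 :> {fraction D} by rewrite tofrac_eq0.
move=> /eqP; rewrite eqr_div ?t0// -!tofracM tofrac_eq => /eqP /(congr1 v).
rewrite !vM => E; have := v_fin y0; have := v_fin b0.
move: E (v_Ny x) (v_Ny a); case: (v b) => // s; case: (v y) => // t.
by case: (v x) => [p||]//; case: (v a) => [q||]// [pq _ _ _ _]; congr EFin;
  apply/eqP; rewrite subr_eq addrAC eq_sym subr_eq pq.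
Qed.

Lemma frac_val_tofrac x : frac_val x%:F = v x.
Proof.
have v1 : v 1 = 0%E.
  have /fineK E := v_fin (oner_neq0 D).
  have := vM 1 1; rewrite mulr1 -E -EFinD => -[] /eqP.
  by rewrite -subr_eq0 opprD addrA subrr add0r oppr_eq0 => /eqP ->.
by have := frac_val_div x (oner_neq0 D); rewrite tofrac1 divr1 v1 sube0.
Qed.

Let frac_valNy z : frac_val z != -oo%E.
Proof.
have [x [y [y0 ->]]] := fractionP z; rewrite frac_val_div//.
by have := v_fin y0; have := v_Ny x; case: (v x) => [a||]//; case: (v y).
Qed.

Let frac_valy z : frac_val z = +oo%E <-> z = 0.
Proof.
split=> [|->]; last by rewrite -tofrac0 frac_val_tofrac; exact/v_y.
have [x [y [y0 ->]]] := fractionP z; rewrite frac_val_div// => E.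
suff -> : x = 0 by rewrite tofrac0 mul0r.
by apply/v_y; have := v_fin y0; move: E; case: (v x) => [a||]//; case: (v y).
Qed.

Let frac_valM x y : frac_val (x * y) = (frac_val x + frac_val y)%E.
Proof.
have [a [b [b0 ->]]] := fractionP x; have [c [d [d0 ->]]] := fractionP y.
rewrite mulf_div -!tofracM !frac_val_div ?mulf_neq0// !vM.
by rewrite fin_num_oppeD ?v_fin// addeACA.
Qed.

Let frac_valD x y :
  (Order.min (frac_val x) (frac_val y) <= frac_val (x + y)%R)%E.
Proof.
have [a [b [b0 ->]]] := fractionP x; have [c [d [d0 ->]]] := fractionP y.
have b0' : b%:F != 0 :> {fraction D} by rewrite tofrac_eq0.
have d0' : d%:F != 0 :> {fraction D} by rewrite tofrac_eq0.
have -> : a%:F / b%:F = (a * d)%:F / (b * d)%:F :> {fraction D}.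
  by rewrite !tofracM -mulf_div divff// mulr1.
have -> : c%:F / d%:F = (b * c)%:F / (b * d)%:F :> {fraction D}.
  by rewrite !tofracM -mulf_div divff// mul1r.
rewrite -mulrDl -tofracD !frac_val_div ?mulf_neq0//.
have := vD (a * d) (b * c); rewrite !ge_min => /orP[] h; apply/orP; [left|right];
  exact: leeD.
Qed.

Definition frac_valuation : valuation R {fraction D} :=
  Valuation frac_valNy frac_valy frac_valM frac_valD.

End fraction_valuation.

Section gauss.
Context {R : realType} {K : fieldType} (v : valuation R K) (g : R).
Implicit Types p q : {poly K}.

Let h p i := (v p`_i%R + (g *+ i)%R%:E)%E.

Definition gauss_val p := \big[Order.min/+oo%E]_(i < size p) h p i.

(** Coefficients past the size vanish and contribute [+oo], so the minimum can be tested on all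
    indices, with no care for the degrees of sums and products. *)
Lemma le_gauss_val a p :
  (a <= gauss_val p)%E <-> forall i, (a <= v p`_i%R + (g *+ i)%R%:E)%E.
Proof.
split=> [le i|le].
  have [ip|ip] := ltnP i (size p); last first.
    by rewrite nth_default// valuation0 addye ?leey.
  apply: le_trans le _; rewrite /gauss_val (bigD1 (Ordinal ip))//=.
  by rewrite ge_min lexx.
rewrite /gauss_val; elim/big_ind: _ => [|x y ax ay|i _]; first exact: leey.
- by rewrite le_min ax.
- exact: le.
Qed.

(** The least index is taken so that the inequality is strict below it, which singles out one term
    in a product. The coefficient there is nonzero: otherwise every term would have value [+oo],
    against the leading coefficient. *)
Lemma gauss_val_attained p : p != 0 -> exists i, [/\ p`_i != 0,
  gauss_val p = h p i & forall j, (j < i)%N -> (gauss_val p < h p j)%E].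
Proof.
move=> p0; have : exists i, gauss_val p == h p i.
  rewrite /gauss_val; have : (0 < size p)%N by rewrite size_poly_gt0.
  case: (size p) => // n _; elim: n => [|n [i /eqP IH]].
    by exists 0%N; rewrite big_ord_recl big_ord0 minEle leey.
  rewrite big_ord_recr/= IH minEle; case: ifPn => _.
  - by exists i.
  - by exists n.+1.
move=> /ex_minnP[i /eqP E min]; exists i; split => //.
  apply/eqP => pi0.
  have /le_gauss_val : (+oo <= gauss_val p)%E.
    by rewrite E /h pi0 valuation0 addye.
  move=> /(_ (size p).-1); have : p`_(size p).-1 != 0.
    by rewrite -[_`__]/(lead_coef p) lead_coef_eq0.
  by move=> /(valuation_fin v)[r ->].
move=> j ji; rewrite lt_neqAle; apply/andP; split.
  by apply/negP => /min; rewrite leqNgt ji.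
by move: j {ji}; apply/le_gauss_val.
Qed.

Lemma gauss_valNy p : gauss_val p != -oo%E.
Proof.
have [->|/gauss_val_attained[i [/(valuation_fin v)[r +] -> _]]] := eqVneq p 0.
  by rewrite /gauss_val size_poly0 big_ord0.
by rewrite /h => ->.
Qed.

Lemma gauss_valy p : gauss_val p = +oo%E <-> p = 0.
Proof.
split=> [|->]; last by rewrite /gauss_val size_poly0 big_ord0.
have [//|/gauss_val_attained[i [/(valuation_fin v)[r +] -> _]]] := eqVneq p 0.
by rewrite /h => ->.
Qed.

Lemma gauss_valD p q :
  (Order.min (gauss_val p) (gauss_val q) <= gauss_val (p + q)%R)%E.
Proof.
apply/le_gauss_val => i; rewrite coefD.
apply: (@le_trans _ _ (Order.min (h p i) (h q i))).
  rewrite le_min !ge_min; apply/andP; split; apply/orP; [left|right];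
    by move: i; apply/le_gauss_val.
rewrite /h; have := valuationD v p`_i q`_i.
by rewrite !ge_min => /orP[] ?; apply/orP; [left|right]; rewrite leeD.
Qed.

(* The coefficient of p * q at i0 + j0, where i0 and j0 are the least indices
   reaching the minima for p and q, has a single term of least valuation. *)
Lemma gauss_valM p q : gauss_val (p * q) = (gauss_val p + gauss_val q)%E.
Proof.
have [->|p0] := eqVneq p 0.
  have [_ /(_ erefl)E] := gauss_valy 0; rewrite mul0r E.
  by rewrite addye ?gauss_valNy.
have [->|q0] := eqVneq q 0.
  have [_ /(_ erefl)E] := gauss_valy 0; rewrite mulr0 E.
  by rewrite addey ?gauss_valNy.
have hD i j : (v (p`_i * q`_j)%R + (g *+ (i + j))%R%:E = h p i + h q j)%E.
  by rewrite valuationM mulrnDr EFinD addeACA.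
have hp i : (gauss_val p <= h p i)%E by move: i; apply/le_gauss_val.
have hq i : (gauss_val q <= h q i)%E by move: i; apply/le_gauss_val.
have [m Em] : exists m, gauss_val p = m%:E.
  have := gauss_valNy p; have := gauss_valy p.
  case: (gauss_val p) => [m| |]//; first by exists m.
  by case=> /(_ erefl)/eqP; rewrite (negbTE p0).
have [n En] : exists n, gauss_val q = n%:E.
  have := gauss_valNy q; have := gauss_valy q.
  case: (gauss_val q) => [n| |]//; first by exists n.
  by case=> /(_ erefl)/eqP; rewrite (negbTE q0).
apply/eqP; rewrite eq_le; apply/andP; split; last first.
  apply/le_gauss_val => k; rewrite coefM.
  rewrite -leeBlDr//; apply: valuation_le_sum => i _; rewrite leeBlDr//.
  rewrite -[in (g *+ k)](subnKC (ltn_ord i : (i <= k)%N)) hD.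
  exact: leeD.
have [i [pi Ei lti]] := gauss_val_attained p0.
have [j [qj Ej ltj]] := gauss_val_attained q0.
have /le_gauss_val/(_ (i + j)%N) := lexx (gauss_val (p * q)).
move=> /le_trans; apply; rewrite coefM.
have ik : (i < (i + j).+1)%N by rewrite ltnS leq_addr.
rewrite (bigD1 (Ordinal ik))//= addKn Ei Ej -hD valuationDl//.
have : (v (p`_i * q`_j)%R + (g *+ (i + j))%R%:E = (m + n)%R%:E)%E.
  by rewrite hD -Ei -Ej Em En.
have [r ->] : exists r, v (p`_i * q`_j)%R = r%:E.
  by apply: valuation_fin; rewrite mulf_neq0.
rewrite -EFinD => -[E].
apply: valuation_lt_sum => [|a ai]; first exact: ltry.
have ak := ltn_ord a; rewrite ltnS in ak.
suff : ((m + n)%R%:E < v (p`_a * q`_(i + j - a))%R + (g *+ (i + j))%R%:E)%E.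
  by rewrite -E EFinD lteD2rE.
rewrite -[in (g *+ _)](subnKC ak) hD EFinD -Em -En.
have : (a < i)%N || (i + j - a < j)%N.
  have : (a != i :> nat) by apply: contra ai => /eqP ai; apply/eqP/val_inj.
  case: (ltngtP a i) => //= ia _; by rewrite ltn_subLR// ltn_add2r.
by case/orP => [/lti|/ltj] lt; [apply: lte_leD|apply: lee_ltD] => //;
  rewrite ?Em ?En.
Qed.

Definition gauss_valuation : valuation R {fraction {poly K}} :=
  frac_valuation gauss_valNy gauss_valy gauss_valM gauss_valD.

Lemma gauss_valuationE p : gauss_valuation p%:F = gauss_val p.
Proof.
exact: (frac_val_tofrac gauss_valNy gauss_valy gauss_valM).
Qed.

Definition gauss_embed (a : K) : {fraction {poly K}} := (a%:P)%:F.

End gauss.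

HB.instance Definition _ (K : fieldType) :=
  GRing.RMorphism.copy (@gauss_embed K) (@FracField.tofrac {poly K} \o polyC).

Lemma range_valuationE (R : realType) (K : fieldType) (v : valuation R K)
  (G : {pred R}) : range v `<=` adjoin_infty G <->
  forall x, x != 0 -> exists2 r, r \in G & v x = r%:E.
Proof.
split=> [vG x x0|vG _ [x _ <-]].
  have : adjoin_infty G (v x) by apply: vG; exists x.
  case=> [[r rG <-]|/valuation_eqy/eqP]; first by exists r.
  by rewrite (negbTE x0).
have [->|/vG[r rG ->]] := eqVneq x 0; first by right; rewrite valuation0.
by left; exists r.
Qed.

(** The minimum is attained at a nonzero coefficient, so a nonzero polynomial has a value of the
    form v(p_i) + i g, which lies in [G]; quotients follow by subtraction. *)
Lemma gauss_range (R : realType) (K : fieldType) (v : valuation R K)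
  (G : zmodClosed R) (g : R) : g \in G -> range v `<=` adjoin_infty G ->
  range (gauss_valuation v g) `<=` adjoin_infty G.
Proof.
move=> gG /range_valuationE vG; apply/range_valuationE.
have polyG p : p != 0 -> exists2 r, r \in G & gauss_val v g p = r%:E.
  move=> /(gauss_val_attained v g)[i [/vG[r rG +] -> _]] => ->.
  by exists (r + g *+ i); [rewrite rpredD// rpredMn|].
move=> z z0; have [p [q [q0 E]]] := fractionP z.
have p0 : p != 0.
  by move: z0; rewrite E; apply: contraNneq => ->; rewrite tofrac0 mul0r.
rewrite E valuation_div ?tofrac_eq0// !gauss_valuationE.
have [r rG ->] := polyG _ p0; have [s sG ->] := polyG _ q0.
by exists (r - s); first rewrite rpredB.
Qed.

(** * Adjoining finitely many points *)

(** The exponents of an ultrametric, e = - log_eta d: distance 0 becomes [+oo], the maximum of the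
    ultrametric inequality becomes a minimum, and being R-valued becomes having values in [G] off
    the diagonal. *)
Record log_ultrametric (R : realType) (G : {pred R}) (Y : eqType)
  (e : Y -> Y -> \bar R) : Prop := LogUltrametric {
  log_ultraxx : forall a, e a a = +oo%E ;
  log_ultra_neq : forall a b, a != b -> exists2 r, r \in G & e a b = r%:E ;
  log_ultraC : forall a b, e a b = e b a ;
  log_ultra_min : forall a b c, (Order.min (e a b) (e b c) <= e a c)%E }.

Section extensions.
Context {R : realType} (G : zmodClosed R) {K : fieldType} (v : valuation R K).
Context {Y : eqType} (o : Y) (e : Y -> Y -> \bar R).
Hypothesis vG : range v `<=` adjoin_infty G.
Hypothesis eU : log_ultrametric G e.

Record pointed_ext := PointedExt {
  pfield : fieldType ;
  pval : valuation R pfield ;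
  pemb : {rmorphism K -> pfield} ;
  ppt : Y -> pfield }.
Implicit Types (E D : pointed_ext) (s : seq Y).

(** [y] and [z] are the values in [E] and [D] of one polynomial expression in constants and the
    points of [o :: s]. A relation is used because nothing says beforehand that this correspondence
    is a map. Negation needs no constructor, -1 being a constant. *)
Inductive genrel (s : seq Y) E D : pfield E -> pfield D -> Prop :=
| genrel_const k : genrel s (pemb E k) (pemb D k)
| genrel_pt a : a \in o :: s -> genrel s (ppt E a) (ppt D a)
| genrel_add y z y' z' :
    genrel s y z -> genrel s y' z' -> genrel s (y + y') (z + z')
| genrel_mul y z y' z' :
    genrel s y z -> genrel s y' z' -> genrel s (y * y') (z * z').

Lemma genrel_sym s E D (y : pfield E) (z : pfield D) :
  genrel s y z -> genrel s z y.
Proof. by elim=> *; constructor. Qed.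

Lemma genrel_sub s s' E D (y : pfield E) (z : pfield D) :
  {subset o :: s <= o :: s'} -> genrel s y z -> genrel s' y z.
Proof. by move=> ss'; elim=> *; constructor => //; exact: ss'. Qed.

Lemma genrel0 s E D : genrel s (0 : pfield E) (0 : pfield D).
Proof. by rewrite -(rmorph0 (pemb E)) -(rmorph0 (pemb D)); constructor. Qed.

Lemma genrel1 s E D : genrel s (1 : pfield E) (1 : pfield D).
Proof. by rewrite -(rmorph1 (pemb E)) -(rmorph1 (pemb D)); constructor. Qed.

Lemma genrelN s E D (y : pfield E) (z : pfield D) :
  genrel s y z -> genrel s (- y) (- z).
Proof.
move=> yz; rewrite -mulN1r -(mulN1r z); apply: genrel_mul => //.
by rewrite -(rmorphN1 (pemb E)) -(rmorphN1 (pemb D)); constructor.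
Qed.

Lemma genrel_sum s E D (I : Type) (r : seq I)
    (P : pred I) (F : I -> pfield E) (H : I -> pfield D) :
  (forall i, P i -> genrel s (F i) (H i)) ->
  genrel s (\sum_(i <- r | P i) F i) (\sum_(i <- r | P i) H i).
Proof.
move=> FH; elim/big_ind2 : _ => [|y z y' z'|//]; first exact: genrel0.
exact: genrel_add.
Qed.

Definition dominating s D :=
  [/\ valued_extension v (pval D) (pemb D), ppt D o = 0
    & forall a b, a \in o :: s -> b \in o :: s ->
        (e a b <= pval D (ppt D a - ppt D b)%R)%E].

(** A dominating extension may have its points closer together than [e] prescribes; a universal one
    has the exact distances and the least valuation on polynomial expressions. For [y = 0] the last
    clause forces [z = 0], so it also makes [genrel] single-valued from [E] to [D]. *)
Definition universal s E :=
  [/\ valued_extension v (pval E) (pemb E),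
      range (pval E) `<=` adjoin_infty G,
      ppt E o = 0,
      forall a b, a \in o :: s -> b \in o :: s ->
        pval E (ppt E a - ppt E b) = e a b
    & forall D, dominating s D -> forall (y : pfield E) (z : pfield D),
        genrel s y z -> (pval E y <= pval D z)%E].

Lemma universal_dominating s E : universal s E -> dominating s E.
Proof.
by case=> ? ? ? sE ?; split => // a b sa sb; rewrite sE.
Qed.

Lemma universal_eq s s' E : o :: s =i o :: s' -> universal s E -> universal s' E.
Proof.
move=> ss' [E1 E2 E3 E4 E5]; split => //.
- by move=> a b; rewrite -!ss'; exact: E4.
- move=> D [D1 D2 D3] y z yz; apply: (E5 D).
  + by split => // a b; rewrite !ss'; exact: D3.
  + by apply: genrel_sub yz => a; rewrite ss'.
Qed.

Lemma exists_nearest s x :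
  exists2 j, j \in o :: s & forall a, a \in o :: s -> (e x a <= e x j)%E.
Proof.
elim: s => [|b s [j js jmax]].
  by exists o; [rewrite inE|move=> a; rewrite inE => /eqP ->].
have [le|lt] := leP (e x b) (e x j).
  exists j; first by move: js; rewrite !inE orbCA => ->; rewrite orbT.
  move=> a; rewrite !inE orbCA => /orP[/eqP ->//|]; rewrite -in_cons.
  exact: jmax.
exists b; first by rewrite !inE eqxx orbT.
move=> a; rewrite !inE orbCA => /orP[/eqP ->//|]; rewrite -in_cons => /jmax h.
exact: le_trans h (ltW lt).
Qed.

Definition pointed_morph s E E' (phi : {rmorphism pfield E -> pfield E'}) :=
  [/\ valued_extension (pval E) (pval E') phi,
      forall k, phi (pemb E k) = pemb E' k
    & forall a, a \in o :: s -> phi (ppt E a) = ppt E' a].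

Lemma genrel_morph s E E' D D' (phi : {rmorphism pfield E -> pfield E'})
    (psi : {rmorphism pfield D -> pfield D'}) y z :
  pointed_morph s phi -> pointed_morph s psi ->
  genrel s y z -> genrel s (phi y) (psi z).
Proof.
move=> [_ phik phip] [_ psik psip]; elim.
- by move=> k; rewrite phik psik; constructor.
- by move=> a sa; rewrite phip// psip//; constructor.
- by move=> *; rewrite !rmorphD; constructor.
- by move=> *; rewrite !rmorphM; constructor.
Qed.

(** Minimality of the Gauss valuation: the bound on [t] makes each term of the expansion of [z.[t]]
    at least as large as the term of the same index in the Gauss minimum of [y]. *)
Lemma le_pval_horner E D (y : {poly pfield E}) (z : {poly pfield D}) g t :
  (forall i, (pval E y`_i%R <= pval D z`_i%R)%E) -> (g%:E <= pval D t)%E ->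
  (gauss_val (pval E) g y <= pval D z.[t]%R)%E.
Proof.
move=> yz gt; rewrite horner_coef; apply: valuation_le_sum => i _.
have /le_gauss_val/(_ i)/le_trans := lexx (gauss_val (pval E) g y); apply.
by rewrite valuationM leeD// valuationX_ge.
Qed.

Section adjoin_point.
Variables (s : seq Y) (E : pointed_ext) (x j : Y) (g : R).
Hypothesis uE : universal s E.
Hypothesis (js : j \in o :: s) (xj : e x j = g%:E).
Hypothesis jmax : forall a, a \in o :: s -> (e x a <= e x j)%E.

Let xs : x \notin o :: s.
Proof.
by apply/negP => /jmax; rewrite xj (log_ultraxx eU).
Qed.

Definition adjoin_pt : pointed_ext :=
  PointedExt (gauss_valuation (pval E) g) (@gauss_embed _ \o pemb E)
    (fun y => if y == x then ((ppt E j)%:P + 'X)%:F else gauss_embed (ppt E y)).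

Lemma adjoin_ptE a : a \in o :: s ->
  ppt adjoin_pt a = gauss_embed (ppt E a).
Proof. by move=> /= sa; case: eqP xs => // <-; rewrite sa. Qed.

Lemma gauss_valC (c : pfield E) : gauss_val (pval E) g c%:P = pval E c.
Proof.
apply/eqP; rewrite eq_le; apply/andP; split.
  have /le_gauss_val/(_ 0%N) := lexx (gauss_val (pval E) g c%:P).
  by rewrite coefC/= adde0.
apply/le_gauss_val => -[|i]; rewrite coefC/= ?adde0//.
by rewrite valuation0 addye// leey.
Qed.

Lemma gauss_valCX (c : pfield E) :
  gauss_val (pval E) g (c%:P - 'X) = Order.min (pval E c) g%:E.
Proof.
apply/eqP; rewrite eq_le; apply/andP; split.
  have /le_gauss_val h := lexx (gauss_val (pval E) g (c%:P - 'X)).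
  rewrite le_min; have := h 0%N; rewrite !coefE/= subr0 adde0 => ->/=.
  by have := h 1%N; rewrite !coefE/= sub0r valuationN valuation1 add0e.
apply/le_gauss_val => -[|[|i]]; rewrite !coefE/= ?subr0 ?sub0r.
- by rewrite adde0 ge_min lexx.
- by rewrite valuationN valuation1 add0e ge_min lexx orbT.
- by rewrite ?oppr0 ?subrr valuation0 addye// leey.
Qed.

Lemma adjoin_pt_morph : pointed_morph s (@gauss_embed (pfield E) :
  {rmorphism pfield E -> pfield adjoin_pt}).
Proof.
split=> // [c|a sa].
- by rewrite [LHS](gauss_valuationE _ _ c%:P) gauss_valC.
- by rewrite adjoin_ptE.
Qed.

Lemma pval_adjoin_pt c :
  pval adjoin_pt (gauss_embed c - ppt adjoin_pt x) =
  Order.min (pval E (c - ppt E j)) g%:E.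
Proof.
rewrite /= eqxx -tofracB opprD addrA -polyCB.
by rewrite [LHS](gauss_valuationE _ _ (_ - 'X)) gauss_valCX.
Qed.

(** Evaluating at T_j + X amounts to composing with X + T_j, which is undone by the opposite
    translation. *)
Lemma adjoin_pt_indep (p : {poly pfield E}) :
  (map_poly (@gauss_embed _) p).[ppt adjoin_pt x] = 0 -> p = 0.
Proof.
rewrite /= eqxx.
have -> : (map_poly (@gauss_embed (pfield E)) p).[((ppt E j)%:P + 'X)%:F] =
  (p \Po ('X + (ppt E j)%:P))%:F.
  rewrite /comp_poly -horner_map/= [X in _ = _.[X%:F]]addrC; congr _.[_].
  by rewrite -map_poly_comp.
move=> /eqP; rewrite tofrac_eq0 => /eqP h.
have := comp_polyXaddC_K p (ppt E j); rewrite h comp_poly0.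
by move=> <-.
Qed.

(** The left side is the minimum of e a j and e j x. It is at most e a x by the ultrametric
    inequality through [j]; conversely e a x is at most e x j because [j] is nearest to [x], and
    then at most e a j by the inequality through [x]. *)
Let e_adjoin a : a \in o :: s ->
  pval adjoin_pt (ppt adjoin_pt a - ppt adjoin_pt x) = e a x.
Proof.
move=> sa; rewrite adjoin_ptE// pval_adjoin_pt -xj.
have [_ _ _ -> // _] := uE.
apply/eqP; rewrite eq_le; apply/andP; split.
  rewrite [X in Order.min _ X](log_ultraC eU).
  exact: (log_ultra_min eU).
rewrite le_min (log_ultraC eU a x) jmax// andbT.
have := log_ultra_min eU a x j; rewrite (log_ultraC eU a x).
by rewrite min_l// jmax.
Qed.

(** Expands an expression in the enlarged set of points along powers of T_x - T_j, which is the
    indeterminate in [adjoin_pt]; the coefficients on both sides are again related, now over [s]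
    alone. *)
Lemma adjoin_pt_rel D (y : pfield adjoin_pt) (z : pfield D) :
  genrel (x :: s) y z ->
  exists (p : {poly pfield E}) (q : {poly pfield D}),
    [/\ forall i, genrel s p`_i q`_i, y = p%:F
      & z = q.[ppt D x - ppt D j]].
Proof.
elim=> {y z} [k|a|y z y' z' _ [p [q [pq -> ->]]] _ [p' [q' [pq' -> ->]]]
  |y z y' z' _ [p [q [pq -> ->]]] _ [p' [q' [pq' -> ->]]]].
- exists (pemb E k)%:P, (pemb D k)%:P; split => //; last by rewrite hornerC.
  by move=> [|i]; rewrite !coefC/=; [constructor|exact: genrel0].
- rewrite !inE orbCA -in_cons => /orP[/eqP ->|sa].
    exists ((ppt E j)%:P + 'X), ((ppt D j)%:P + 'X); split.
    + move=> [|[|i]]; rewrite !coefE/= ?addr0 ?add0r.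
      * by constructor.
      * exact: genrel1.
      * exact: genrel0.
    + by rewrite /= eqxx.
    + by rewrite hornerD hornerC hornerX addrC subrK.
  exists (ppt E a)%:P, (ppt D a)%:P; split; last by rewrite hornerC.
    by move=> [|i]; rewrite !coefC/=; [constructor|exact: genrel0].
  by rewrite adjoin_ptE.
- exists (p + p'), (q + q'); rewrite hornerD tofracD; split => // i.
  by rewrite !coefD; constructor.
- exists (p * p'), (q * q'); rewrite hornerM tofracM; split => // i.
  by rewrite !coefM; apply: genrel_sum => k _; constructor.
Qed.

Lemma universal_adjoin_pt : universal (x :: s) adjoin_pt.
Proof.
have [E1 E2 E3 E4 E5] := uE.
have pG : g \in G.
  have [|r rG] := log_ultra_neq eU (_ : x != j).
    by apply: contraNneq xs => ->.
  by rewrite xj => -[->].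
split.
- move=> k; rewrite [LHS](gauss_valuationE _ _ (pemb E k)%:P) gauss_valC.
  exact: E1.
- exact: gauss_range.
- by rewrite adjoin_ptE ?inE ?eqxx// E3 /gauss_embed/= rmorph0.
- move=> a b; rewrite !inE orbCA -in_cons => /orP[/eqP ->|sa];
    rewrite orbCA -in_cons => /orP[/eqP ->|sb].
  + by rewrite subrr valuation0 (log_ultraxx eU).
  + by rewrite valuation_distC e_adjoin// (log_ultraC eU).
  + exact: e_adjoin.
  + rewrite !adjoin_ptE// -rmorphB.
    by have [-> _ _] := adjoin_pt_morph; rewrite E4.
(* [D] also dominates for [s], so the minimality of [E] compares the coefficients, while the
   inequality imposed on the pair [x], [j] is the bound on T_x - T_j that the evaluation
   requires. *)
- move=> D [D1 D2 D3] y z /adjoin_pt_rel[p [q [pq -> ->]]].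
  rewrite [leLHS]gauss_valuationE; apply: le_pval_horner.
    move=> i; apply: E5 (pq i); split => // a b sa sb.
    by apply: D3; rewrite !inE orbCA -in_cons (sa, sb) orbT.
  rewrite -xj; apply: D3; first by rewrite !inE eqxx orbT.
  by rewrite !inE orbCA -in_cons js orbT.
Qed.

End adjoin_point.

Lemma universal_nil : universal [::] (PointedExt v idfun (fun=> 0)).
Proof.
split => //.
- move=> a b; rewrite !inE => /eqP -> /eqP ->.
  by rewrite subr0 valuation0 (log_ultraxx eU).
- move=> D [D1 D2 D3] y z yz.
  suff -> : z = pemb D y by rewrite D1.
  elim: yz => //= [a|y' z' y'' z'' _ -> _ ->|y' z' y'' z'' _ -> _ ->].
  + by rewrite !inE rmorph0 => /eqP ->.
  + by rewrite rmorphD.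
  + by rewrite rmorphM.
Qed.

(** All that is kept of the Gauss construction. The transcendence of the new point serves algebraic
    independence; the last clause serves closedness, since it says that a distance to the new point
    is never less than the distance to an old one. *)
Lemma universal_cons s E x : universal s E -> x \notin o :: s ->
  exists E' (phi : {rmorphism pfield E -> pfield E'}),
    [/\ universal (x :: s) E', pointed_morph s phi,
      forall p, (map_poly phi p).[ppt E' x] = 0 -> p = 0
    & exists2 j, j \in o :: s & forall c,
        (pval E' (phi c - ppt E' x)%R <= pval E (c - ppt E j)%R)%E].
Proof.
move=> uE xs; have [j js jmax] := exists_nearest s x.
have [|g _ xj] := log_ultra_neq eU (_ : x != j).
  by apply: contraNneq xs => ->.
exists (adjoin_pt E x j g), (@gauss_embed (pfield E)); split.
- exact: universal_adjoin_pt.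
- exact: adjoin_pt_morph.
- exact: adjoin_pt_indep.
- by exists j => // c; rewrite pval_adjoin_pt ge_min lexx.
Qed.

Lemma pointed_morph_sub s s' E E' (phi : {rmorphism pfield E -> pfield E'}) :
  {subset o :: s <= o :: s'} -> pointed_morph s' phi -> pointed_morph s phi.
Proof. by move=> ss' [? ? h]; split => // a /ss'; exact: h. Qed.

Lemma universal_cat s s' E : universal s E ->
  exists E' (phi : {rmorphism pfield E -> pfield E'}),
    universal (s' ++ s) E' /\ pointed_morph s phi.
Proof.
move=> uE; elim: s' => [|x s' [E' [phi [uE' pphi]]]]; first by exists E, idfun.
have [xs|xs] := boolP (x \in o :: (s' ++ s)).
  exists E', phi; split => //; apply: universal_eq uE' => a.
  move: xs; rewrite !inE; by case: (eqVneq a x) => [-> ->|//]; rewrite orbT.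
have [E'' [psi [uE'' ppsi _ _]]] := universal_cons uE' xs.
exists E'', (psi \o phi); split => //.
have [h1 h2 h3] := pphi; have [k1 k2 k3] := ppsi.
split=> [c|k|a sa]; rewrite /= ?k1 ?h2 ?h3//.
by apply: k3; move: sa; rewrite !inE mem_cat => /orP[->|->]//; rewrite !orbT.
Qed.

Lemma universal_exists s : exists E, universal s E.
Proof.
have [E [phi [uE _]]] := universal_cat s universal_nil.
by exists E; rewrite cats0 in uE.
Qed.

(* Both fields extend to fields attached to the same set of points, where
   minimality applies in both directions. *)
Lemma pval_genrel A s s' E E' (y : pfield E) (z : pfield E') :
  universal s E -> universal s' E' ->
  {subset A <= s} -> {subset A <= s'} ->
  genrel A y z -> pval E y = pval E' z.
Proof.
move=> uE uE' As As' yz.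
have os B C : {subset B <= C} -> {subset o :: B <= o :: C}.
  by move=> BC a; rewrite !inE => /orP[->//|/BC ->]; rewrite orbT.
have [E1 [phi [uE1 pphi]]] := universal_cat s' uE.
have [E2 [psi [uE2 ppsi]]] := universal_cat s uE'.
have {}uE2 : universal (s' ++ s) E2.
  by apply: universal_eq uE2 => a; rewrite !inE !mem_cat [(a \in s) || _]orbC.
have r : genrel (s' ++ s) (phi y) (psi z).
  apply: (@genrel_sub A).
    by apply: os => a /As; rewrite mem_cat => ->; rewrite orbT.
  by apply: genrel_morph yz; [apply: pointed_morph_sub pphi|
    apply: pointed_morph_sub ppsi]; exact: os.
have [<- _ _] := pphi; have [<- _ _] := ppsi.
have [_ _ _ _ m1] := uE1; have [_ _ _ _ m2] := uE2.
apply/eqP; rewrite eq_le m1//; last exact: universal_dominating.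
by rewrite m2//; [exact: universal_dominating|exact: genrel_sym].
Qed.

(** Formal rational expressions, the codes for elements of the glued field. They can be evaluated in
    every extension, [TInv] of an expression with value 0 being 0. *)
Inductive point_term :=
| TConst of K
| TPt of Y
| TAdd of point_term & point_term
| TOpp of point_term
| TMul of point_term & point_term
| TInv of point_term.

Fixpoint tpoints t : seq Y :=
  match t with
  | TConst _ => [::]
  | TPt a => [:: a]
  | TAdd t u | TMul t u => tpoints t ++ tpoints u
  | TOpp t | TInv t => tpoints t
  end.

Fixpoint teval E t : pfield E :=
  match t with
  | TConst k => pemb E k
  | TPt a => ppt E a
  | TAdd t u => teval E t + teval E u
  | TOpp t => - teval E t
  | TMul t u => teval E t * teval E u
  | TInv t => (teval E t)^-1
  end.

(** Minimality speaks of polynomial expressions only, so a term is written as a quotient of two of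
    them, in the same way in both fields. This is consistent because related elements have equal
    values, hence vanish together. *)
Lemma teval_ratio A s s' E E' t :
  universal s E -> universal s' E' ->
  {subset A <= s} -> {subset A <= s'} -> {subset tpoints t <= A} ->
  exists y1 y2 z1 z2, [/\ genrel A y1 z1, genrel A y2 z2, y2 != 0, z2 != 0
    & teval E t = y1 / y2 /\ teval E' t = z1 / z2].
Proof.
move=> uE uE' As As'.
have eq0 (y : pfield E) (z : pfield E') : genrel A y z -> (y == 0) = (z == 0).
  move=> /(pval_genrel uE uE' As As') yz.
  apply/eqP/eqP => [/(valuation_eqy (pval E))|/(valuation_eqy (pval E'))] h.
  - by apply/(valuation_eqy (pval E')); rewrite -yz.
  - by apply/(valuation_eqy (pval E)); rewrite yz.
elim: t => [k|a|t IHt u IHu|t IHt|t IHt u IHu|t IHt] /= tA.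
- exists (pemb E k), 1, (pemb E' k), 1; rewrite !divr1 !oner_neq0; split => //.
  + by constructor.
  + exact: genrel1.
- exists (ppt E a), 1, (ppt E' a), 1; rewrite !divr1 !oner_neq0; split => //.
  + by constructor; rewrite inE tA ?orbT ?inE.
  + exact: genrel1.
- have [|y1 [y2 [z1 [z2 [r1 r2 y20 z20 [-> ->]]]]]] := IHt.
    by move=> a ta; apply: tA; rewrite mem_cat ta.
  have [|y3 [y4 [z3 [z4 [r3 r4 y40 z40 [-> ->]]]]]] := IHu.
    by move=> a ta; apply: tA; rewrite mem_cat ta orbT.
  exists (y1 * y4 + y3 * y2), (y2 * y4), (z1 * z4 + z3 * z2), (z2 * z4).
  rewrite !mulf_neq0// !addf_div//; split => //; last exact: genrel_mul.
  by apply: genrel_add; exact: genrel_mul.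
- have [//|y1 [y2 [z1 [z2 [r1 r2 y20 z20 [-> ->]]]]]] := IHt.
  exists (- y1), y2, (- z1), z2; rewrite !mulNr; split => //.
  exact: genrelN.
- have [|y1 [y2 [z1 [z2 [r1 r2 y20 z20 [-> ->]]]]]] := IHt.
    by move=> a ta; apply: tA; rewrite mem_cat ta.
  have [|y3 [y4 [z3 [z4 [r3 r4 y40 z40 [-> ->]]]]]] := IHu.
    by move=> a ta; apply: tA; rewrite mem_cat ta orbT.
  exists (y1 * y3), (y2 * y4), (z1 * z3), (z2 * z4).
  by rewrite !mulf_neq0// !mulf_div; split => //; exact: genrel_mul.
- have [//|y1 [y2 [z1 [z2 [r1 r2 y20 z20 [-> ->]]]]]] := IHt.
  (* A vanishing numerator cannot become a denominator; the inverse is then 0 by convention, and in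
     both fields at once. *)
  have [y10|y10] := eqVneq y1 0.
    have z10 : z1 = 0 by apply/eqP; rewrite -(eq0 _ _ r1) y10.
    exists 0, 1, 0, 1; rewrite y10 z10 !mul0r !invr0 !oner_neq0; split => //.
    + exact: genrel0.
    + exact: genrel1.
  exists y2, y1, z2, z1; rewrite !invf_div; split => //.
  by rewrite -(eq0 _ _ r1).
Qed.

Lemma pval_teval s s' E E' t :
  universal s E -> universal s' E' ->
  {subset tpoints t <= s} -> {subset tpoints t <= s'} ->
  pval E (teval E t) = pval E' (teval E' t).
Proof.
move=> uE uE' ts ts'.
have [//|y1 [y2 [z1 [z2 [r1 r2 y20 z20 [-> ->]]]]]] :=
  teval_ratio uE uE' ts ts' (_ : {subset tpoints t <= tpoints t}).
rewrite !valuation_div// (pval_genrel uE uE' ts ts' r1).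
by rewrite (pval_genrel uE uE' ts ts' r2).
Qed.

End extensions.

(** * Polynomials in n+1 variables as polynomials in the last variable *)

Lemma mmap_muni (n : nat) (A B : comNzRingType) (f : {rmorphism A -> B})
    (h : 'I_n.+1 -> B) (P : mpoly.mpoly n.+1 A) :
  mpoly.mmap f h P =
  (map_poly (mpoly.mmap f (h \o widen_ord (leqnSn n))) (mpoly.muni P)).[h ord_max].
Proof.
rewrite mpoly.muniE raddf_sum/= horner_sum; apply: eq_bigr => m _.
rewrite map_polyZ hornerZ map_polyXn hornerXn/= mpoly.mmapZ -mulrA; congr (_ * _).
rewrite mpoly.mmapX /mpoly.mmap1 big_ord_recr/=; congr (_ * _).
by apply: eq_bigr => i _; rewrite mpoly.mnmE.
Qed.

(** A multi-exponent is determined by its truncation to the first n entries and its last entry, so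
    each coefficient of [P] is found as a coefficient of a coefficient of [muni P]. *)
Lemma muni_eq0 (n : nat) (A : comNzRingType) (P : mpoly.mpoly n.+1 A) :
  mpoly.muni P = 0 -> P = 0.
Proof.
move=> P0; apply/mpoly.mpolyP => m; rewrite raddf0.
pose trunc (m : mpoly.multinom n.+1) : mpoly.multinom n :=
  mpoly.Multinom [tuple m (widen_ord (leqnSn n) i) | i < n].
have truncE m' : trunc m' = trunc m -> m' ord_max = m ord_max -> m' = m.
  move=> /mpoly.mnmP e emax; apply/mpoly.mnmP => i.
  have [j ->|->] := unliftP ord_max i; last by [].
  have -> : lift ord_max j = widen_ord (leqnSn n) j.
    by apply/val_inj; rewrite /= /bump leqNgt ltn_ord.
  by have := e j; rewrite !mpoly.mnmE.
have : mpoly.mcoeff (trunc m) (mpoly.muni P)`_(m ord_max) = 0.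
  by rewrite P0 coef0 raddf0.
rewrite mpoly.muniE coef_sum raddf_sum/=.
under eq_bigr do rewrite coefZ coefXn mulr_natr raddfMn/= mpoly.mcoeffZ mpoly.mcoeffX.
have [mP|/mpoly.memN_msupp_eq0//] := boolP (m \in mpoly.msupp P).
rewrite (bigD1_seq m) ?mpoly.msupp_uniq//= !eqxx mulr1 mulr1n big1 ?addr0//.
move=> m' m'm; case: eqVneq => [/truncE e|]; last by rewrite mulr0 mul0rn.
by case: eqVneq => [/esym/e/eqP|]; [rewrite (negbTE m'm)|rewrite mulr0n].
Qed.

(** * The extension generated by an ultrametric space *)

HB.instance Definition _ (K : fieldType) (Y : eqType) :=
  gen_eqMixin (@point_term K Y).
HB.instance Definition _ (K : fieldType) (Y : eqType) :=
  gen_choiceMixin (@point_term K Y).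

Section free_extension.
Local Open Scope quotient_scope.
Context {R : realType} (G : zmodClosed R) {K : fieldType} (v : valuation R K).
Context {Y : eqType} (o : Y) (e : Y -> Y -> \bar R).
Hypothesis vG : range v `<=` adjoin_infty G.
Hypothesis eU : log_ultrametric G e.
Local Notation term := (@point_term K Y).
Local Notation pext := (@pointed_ext R K Y).
Local Notation universal := (universal G v o e).
Implicit Types (t u : term) (s : seq Y).

Let ext s : pext := sval (cid (universal_exists o vG eU s)).

Let extP s : universal s (ext s).
Proof. by rewrite /ext; case: cid. Qed.

Definition term_eq t u : bool :=
  let E := ext (tpoints t ++ tpoints u) in teval E t == teval E u.

(** Equality of two terms means that their difference has value [+oo], and by [pval_teval] this
    value is the same in every universal extension containing the points involved. *)
Lemma term_eqE s E t u : universal s E ->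
  {subset tpoints t <= s} -> {subset tpoints u <= s} ->
  term_eq t u = (teval E t == teval E u).
Proof.
move=> uE ts us; rewrite /term_eq; set D := ext _.
have /= h : pval D (teval D (TAdd t (TOpp u))) = pval E (teval E (TAdd t (TOpp u))).
  apply: (pval_teval eU (extP _) uE) => // a /=.
  by rewrite mem_cat => /orP[/ts|/us].
rewrite -subr_eq0 -[RHS]subr_eq0.
apply/eqP/eqP => [/(valuation_eqy (pval D))|/(valuation_eqy (pval E))] h'.
- by apply/(valuation_eqy (pval E)); rewrite -h.
- by apply/(valuation_eqy (pval D)); rewrite h.
Qed.

Let term_eq_refl : reflexive term_eq.
Proof. by move=> t; rewrite /term_eq eqxx. Qed.

Let subl (A B : seq Y) : {subset A <= A ++ B}.
Proof. by move=> a; rewrite mem_cat => ->. Qed.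

Let subr (A B : seq Y) : {subset B <= A ++ B}.
Proof. by move=> a; rewrite mem_cat orbC => ->. Qed.

Let term_eq_sym : symmetric term_eq.
Proof.
move=> t u; rewrite (term_eqE (extP (tpoints u ++ tpoints t)))//.
Qed.

Let term_eq_trans : transitive term_eq.
Proof.
move=> u t w; set s := tpoints t ++ (tpoints u ++ tpoints w).
have us : {subset tpoints u <= s} by move=> a /subl/subr; exact.
have ws : {subset tpoints w <= s} by move=> a /subr/subr; exact.
rewrite !(term_eqE (extP s))//; [|exact: subl..].
by move=> /eqP -> /eqP ->.
Qed.

Canonical term_equiv := EquivRel term_eq term_eq_refl term_eq_sym term_eq_trans.

Definition term_field := {eq_quot term_eq}.

HB.instance Definition _ := EqQuotient.on term_field.
HB.instance Definition _ := Choice.on term_field.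

Local Notation Q := term_field.
Local Notation pi := (\pi_term_field).

Lemma pi_term_eq t u : (pi t == pi u) = term_eq t u.
Proof. by rewrite eqmodE. Qed.

Lemma pi_termE s E t u : universal s E ->
  {subset tpoints t <= s} -> {subset tpoints u <= s} ->
  (pi t == pi u) = (teval E t == teval E u).
Proof. by move=> *; rewrite pi_term_eq (@term_eqE s E). Qed.

(** Transfers to the quotient the identities valid in all fields; most of the field axioms below
    come from here. *)
Lemma pi_term_ext t u : (forall E : pext, teval E t = teval E u) -> pi t = pi u.
Proof. by move=> tu; apply/eqP; rewrite pi_term_eq /term_eq tu. Qed.

(** A representative may involve points absent from [t], so the comparison is made in an extension
    containing the points of both. *)
Let repr_termE s E t : universal s E ->
  {subset tpoints t <= s} -> {subset tpoints (repr (pi t)) <= s} ->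
  teval E (repr (pi t)) = teval E t.
Proof. by move=> uE ts rs; apply/eqP; rewrite -(pi_termE uE)// reprK. Qed.

Definition tq_add (a b : Q) : Q := pi (TAdd (repr a) (repr b)).
Definition tq_opp (a : Q) : Q := pi (TOpp (repr a)).
Definition tq_mul (a b : Q) : Q := pi (TMul (repr a) (repr b)).
Definition tq_inv (a : Q) : Q := pi (TInv (repr a)).

Let pi_op1 (op : term -> term) t :
  (forall t, tpoints (op t) = tpoints t) ->
  (forall (E : pext) t u, teval E t = teval E u -> teval E (op t) = teval E (op u)) ->
  pi (op (repr (pi t))) = pi (op t).
Proof.
move=> opp ope; set r := repr _; apply/eqP.
rewrite (pi_termE (extP (tpoints r ++ tpoints t))) ?opp//.
by apply/eqP/ope/repr_termE; [exact: extP|exact: subr|exact: subl].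
Qed.

Let pi_op2 (op : term -> term -> term) t u :
  (forall t u, tpoints (op t u) = tpoints t ++ tpoints u) ->
  (forall (E : pext) t u t' u', teval E t = teval E t' -> teval E u = teval E u' ->
     teval E (op t u) = teval E (op t' u')) ->
  pi (op (repr (pi t)) (repr (pi u))) = pi (op t u).
Proof.
move=> opp ope; set r := repr _; set r' := repr _; apply/eqP.
set s := (tpoints r ++ tpoints r') ++ (tpoints t ++ tpoints u).
rewrite (pi_termE (extP s)) ?opp//; [|exact: subl|exact: subr].
apply/eqP/ope; apply: repr_termE; try exact: extP.
- by move=> a /subl/subr; exact.
- by move=> a /subl/subl; exact.
- by move=> a /subr/subr; exact.
- by move=> a /subr/subl; exact.
Qed.

Lemma pi_add t u : tq_add (pi t) (pi u) = pi (TAdd t u).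
Proof. by apply: pi_op2 => //= E t1 u1 t2 u2 -> ->. Qed.

Lemma pi_mul t u : tq_mul (pi t) (pi u) = pi (TMul t u).
Proof. by apply: pi_op2 => //= E t1 u1 t2 u2 -> ->. Qed.

Lemma pi_opp t : tq_opp (pi t) = pi (TOpp t).
Proof. by apply: pi_op1 => //= E t1 u1 ->. Qed.

Lemma pi_inv t : tq_inv (pi t) = pi (TInv t).
Proof. by apply: pi_op1 => //= E t1 u1 ->. Qed.

Local Notation const k := (pi (@TConst K Y k)).

Let tq_addA : associative tq_add.
Proof.
elim/quotW => a; elim/quotW => b; elim/quotW => c.
rewrite (pi_add b c) (pi_add a b) !pi_add.
by apply: pi_term_ext => E /=; rewrite addrA.
Qed.

Let tq_addC : commutative tq_add.
Proof.
elim/quotW => a; elim/quotW => b; rewrite !pi_add.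
by apply: pi_term_ext => E /=; rewrite addrC.
Qed.

Let tq_add0 : left_id (const 0) tq_add.
Proof.
by elim/quotW => a; rewrite pi_add; apply: pi_term_ext => E /=; rewrite rmorph0 add0r.
Qed.

Let tq_addN : left_inverse (const 0) tq_opp tq_add.
Proof.
elim/quotW => a; rewrite pi_opp pi_add.
by apply: pi_term_ext => E /=; rewrite rmorph0 addNr.
Qed.

HB.instance Definition _ :=
  GRing.isZmodule.Build term_field tq_addA tq_addC tq_add0 tq_addN.

Let tq_mulA : associative tq_mul.
Proof.
elim/quotW => a; elim/quotW => b; elim/quotW => c.
rewrite (pi_mul b c) (pi_mul a b) !pi_mul.
by apply: pi_term_ext => E /=; rewrite mulrA.
Qed.

Let tq_mulC : commutative tq_mul.
Proof.
elim/quotW => a; elim/quotW => b; rewrite !pi_mul.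
by apply: pi_term_ext => E /=; rewrite mulrC.
Qed.

Let tq_mul1 : left_id (const 1) tq_mul.
Proof.
by elim/quotW => a; rewrite pi_mul; apply: pi_term_ext => E /=; rewrite rmorph1 mul1r.
Qed.

Let tq_mulDl : left_distributive tq_mul (@GRing.add Q).
Proof.
elim/quotW => a; elim/quotW => b; elim/quotW => c.
rewrite -[_ + pi b]/(tq_add _ _) -[RHS]/(tq_add _ _).
rewrite (pi_add a b) (pi_mul a c) (pi_mul b c) pi_add pi_mul.
by apply: pi_term_ext => E /=; rewrite mulrDl.
Qed.

Let tq_nonzero1 : const 1 != 0 :> Q.
Proof.
rewrite -[0]/(const 0) (pi_termE (extP [::]))//= rmorph0 rmorph1.
exact: oner_neq0.
Qed.

HB.instance Definition _ := GRing.Zmodule_isComNzRing.Build term_field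
  tq_mulA tq_mulC tq_mul1 tq_mulDl tq_nonzero1.

Let tq_mulV (a : Q) : a != 0 -> tq_inv a * a = 1.
Proof.
elim/quotW : a => a; rewrite pi_inv -[0]/(const 0) -[_ * _]/(tq_mul _ _) pi_mul.
rewrite (pi_termE (extP (tpoints a)))//= rmorph0 => a0.
apply/eqP; rewrite -[1]/(const 1) (pi_termE (extP (tpoints a)))//=.
  by rewrite rmorph1 mulVf.
by move=> b; rewrite mem_cat => /orP[].
Qed.

Let tq_inv0 : tq_inv 0 = 0.
Proof.
by rewrite -[0]/(const 0) pi_inv; apply: pi_term_ext => E /=; rewrite rmorph0 invr0.
Qed.

HB.instance Definition _ :=
  GRing.ComNzRing_isField.Build term_field tq_mulV tq_inv0.

Definition term_val (a : Q) : \bar R :=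
  let E := ext (tpoints (repr a)) in pval E (teval E (repr a)).

Lemma term_valE s E t : universal s E -> {subset tpoints t <= s} ->
  term_val (pi t) = pval E (teval E t).
Proof.
move=> uE ts; rewrite /term_val; set r := repr _.
set s' := tpoints r ++ tpoints t.
rewrite -(pval_teval eU (extP s') uE (@subr _ _) ts).
have <- : teval (ext s') r = teval (ext s') t.
  by apply: repr_termE; [exact: extP|exact: subr|exact: subl].
by apply: (pval_teval eU (extP _) (extP s')) => //; exact: subl.
Qed.

Let term_valNy a : term_val a != -oo%E.
Proof. exact: valuation_gtNye. Qed.

Let term_valy a : term_val a = +oo%E <-> a = 0.
Proof.
elim/quotW : a => t.
rewrite (term_valE (extP (tpoints t)))// valuation_eqy.
split=> [t0|/eqP].
  by apply/eqP; rewrite -[0]/(const 0) (pi_termE (extP (tpoints t)))//= t0 rmorph0.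
by rewrite -[0]/(const 0) (pi_termE (extP (tpoints t)))//= rmorph0 => /eqP.
Qed.

Let term_valM a b : term_val (a * b) = (term_val a + term_val b)%E.
Proof.
elim/quotW : a => t; elim/quotW : b => u; rewrite -[_ * _]/(tq_mul _ _) pi_mul.
pose s := tpoints t ++ tpoints u; have sE := extP s.
have ts : {subset tpoints t <= s} by exact: subl.
have us : {subset tpoints u <= s} by exact: subr.
by rewrite !(term_valE sE)//= valuationM.
Qed.

Let term_valD a b :
  (Order.min (term_val a) (term_val b) <= term_val (a + b)%R)%E.
Proof.
elim/quotW : a => t; elim/quotW : b => u; rewrite -[(_ + _)%R]/(tq_add _ _) pi_add.
pose s := tpoints t ++ tpoints u; have sE := extP s.
have ts : {subset tpoints t <= s} by exact: subl.
have us : {subset tpoints u <= s} by exact: subr.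
by rewrite !(term_valE sE)//= valuationD.
Qed.

Definition term_valuation : valuation R term_field :=
  Valuation term_valNy term_valy term_valM term_valD.

Definition term_const (k : K) : term_field := const k.

Let term_const_zmod_morphism : zmod_morphism term_const.
Proof.
move=> x y; rewrite -[RHS]/(tq_add _ (tq_opp _)) pi_opp pi_add.
by apply: pi_term_ext => E /=; rewrite rmorphB.
Qed.

Let term_const_monoid_morphism : monoid_morphism term_const.
Proof.
split=> // x y; rewrite -[RHS]/(tq_mul _ _) pi_mul.
by apply: pi_term_ext => E /=; rewrite rmorphM.
Qed.

HB.instance Definition _ := GRing.isZmodMorphism.Build K term_field term_const
  term_const_zmod_morphism.
HB.instance Definition _ := GRing.isMonoidMorphism.Build K term_field term_const
  term_const_monoid_morphism.

Definition term_pt (a : Y) : term_field := pi (@TPt K Y a).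

Lemma term_valuation_const : valued_extension v term_valuation term_const.
Proof.
move=> k; rewrite [LHS](term_valE (extP [::]))//=.
by have [+ _ _ _ _] := extP [::]; exact.
Qed.

Lemma term_valuation_range : range term_valuation `<=` adjoin_infty G.
Proof.
move=> _ [a _ <-]; elim/quotW : a => t.
rewrite [X in _ X](term_valE (extP (tpoints t)))//.
by have [_ + _ _ _] := extP (tpoints t); apply; exists (teval (ext (tpoints t)) t).
Qed.

Lemma term_pt0 : term_pt o = 0.
Proof.
apply/eqP; rewrite -[0]/(const 0) (pi_termE (extP [:: o]))//= rmorph0.
by have [_ _ -> _ _] := extP [:: o].
Qed.

Lemma term_valuation_pt a b : term_valuation (term_pt a - term_pt b) = e a b.
Proof.
rewrite -[_ - _]/(tq_add _ (tq_opp _)) pi_opp pi_add.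
rewrite [LHS](term_valE (extP [:: a; b]))//=.
have [_ _ _ h _] := extP [:: a; b]; rewrite h//; by rewrite !inE eqxx/= !orbT.
Qed.

(* f involves finitely many points A, and adding a new point x to A never brings
   f - T_x closer to 0 than f - T_j, where j is a point nearest to x in A. *)
Lemma term_valuation_bounded (f : term_field) : (exists a, f = term_pt a) \/
  exists M : R, forall a, (term_valuation (f - term_pt a)%R <= M%:E)%E.
Proof.
elim/quotW : f => t; set A := tpoints t; set E := ext A.
have uE : universal A E := extP A.
have [[a aA ta]|nt] := pselect (exists2 a, a \in o :: A & teval E t = ppt E a).
  left; move: aA; rewrite inE => /orP[/eqP ao|aA].
    exists o; rewrite term_pt0; apply/eqP; rewrite -[0]/(const 0).
    rewrite (pi_termE uE)//= ta rmorph0 ao.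
    by have [_ _ -> _ _] := uE.
  exists a; apply/eqP; rewrite (pi_termE uE) ?ta//= => b.
  by rewrite inE => /eqP ->.
right; have [M MP] : exists M : R, forall a, a \in o :: A ->
    (pval E (teval E t - ppt E a)%R <= M%:E)%E.
  have : forall a, a \in o :: A -> teval E t - ppt E a != 0.
    by move=> a aA; rewrite subr_eq0; apply/eqP => ta; apply: nt; exists a.
  elim: (o :: A) => [_|a s IH h]; first by exists 0.
  have [|M MP] := IH; first by move=> b bs; apply: h; rewrite inE bs orbT.
  have [r Er] := valuation_fin (pval E) (h a (mem_head _ _)).
  exists (Num.max r M) => b; rewrite inE => /orP[/eqP ->|/MP].
    by rewrite Er lee_fin le_max lexx.
  by move/le_trans; apply; rewrite lee_fin le_max lexx orbT.
exists M => x; rewrite -[(_ - _)%R]/(tq_add _ (tq_opp _)) pi_opp pi_add.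
have [xA|xA] := boolP (x \in o :: A).
  have uE' : universal (x :: A) E.
    apply: universal_eq uE => a; rewrite !inE.
    by case: (eqVneq a x) => // ->; move: xA; rewrite inE => ->; rewrite orbT.
  rewrite [leLHS](term_valE uE')/=; first exact: MP.
  by move=> a; rewrite mem_cat inE => /orP[|/eqP ->]; rewrite inE ?eqxx// => ->;
    rewrite orbT.
have [E' [phi [uE' [phiv phik phip] _ [j jA h]]]] := universal_cons eU uE xA.
rewrite [leLHS](term_valE uE')/=; last first.
  by move=> a; rewrite mem_cat inE => /orP[|/eqP ->]; rewrite inE ?eqxx// => ->;
    rewrite orbT.
suff <- : phi (teval E t) = teval E' t by exact: le_trans (h _) (MP _ jA).
have : {subset tpoints t <= o :: A} by move=> a aA; rewrite inE aA orbT.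
elim: (t) => /= [k _|a ah|t1 IH1 t2 IH2 h12|t1 IH1 h1|t1 IH1 t2 IH2 h12|t1 IH1 h1].
- exact: phik.
- by apply: phip; apply: ah; rewrite inE.
- rewrite rmorphD IH1 ?IH2// => a ha; apply: h12; rewrite mem_cat ha//.
  by rewrite orbT.
- by rewrite rmorphN IH1.
- rewrite rmorphM IH1 ?IH2// => a ha; apply: h12; rewrite mem_cat ha//.
  by rewrite orbT.
- by rewrite fmorphV IH1.
Qed.

(** The points are adjoined in the order of [x]. A relation, read as a polynomial in the last point,
    has zero coefficients because that point is transcendental over the previous field, and these
    coefficients are relations between the earlier points. One such extension suffices, since terms
    may be evaluated in any. The point [o] is excluded because it is sent to 0. *)
Lemma universal_indep n (x : 'I_n -> Y) : injective x -> (forall i, x i != o) ->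
  exists s E, [/\ universal s E, forall a, (a \in s) = [exists i, a == x i]
    & forall P, mpoly.mmap (pemb E) (ppt E \o x) P = 0 -> P = 0].
Proof.
elim: n x => [|n IH] x xinj xo.
  exists [::], (PointedExt v idfun (fun=> 0)); split.
  - exact: universal_nil.
  - by move=> a; rewrite in_nil; apply/esym/negbTE/existsPn => -[].
  - move=> P; rewrite /mpoly.mmap => P0.
    apply/mpoly.mpolyP => m; rewrite raddf0; apply/eqP/negPn/negP.
    rewrite -mpoly.mcoeff_msupp => mP; move: P0.
    rewrite (bigD1_seq m) ?mpoly.msupp_uniq//= big1 ?addr0.
      rewrite /mpoly.mmap1 big_ord0 mulr1 => /eqP.
      by move: mP; rewrite mpoly.mcoeff_msupp => /negP.
    move=> m' /negP[]; apply/eqP/mpoly.mnmP; by case.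
pose x' := x \o widen_ord (leqnSn n).
have [| |s [E [uE sx indE]]] := IH x'.
- by move=> i j /xinj /(congr1 val)/= /val_inj.
- by move=> i; exact: xo.
have xs : x ord_max \notin o :: s.
  rewrite inE negb_or xo/= sx; apply/existsPn => i; apply/negP => /eqP /xinj.
  by move=> /(congr1 val)/= h; have := ltn_ord i; rewrite -h ltnn.
have [E' [phi [uE' [phiv phik phip] ind _]]] := universal_cons eU uE xs.
exists (x ord_max :: s), E'; split => //.
  move=> a; rewrite inE sx; apply/orP/existsP.
    case=> [/eqP ->|/existsP[i /eqP ->]]; first by exists ord_max.
    by exists (widen_ord (leqnSn n) i).
  case=> i /eqP ->; have [j ->|->] := unliftP ord_max i; last by left.
  right; apply/existsP; exists j; apply/eqP; congr x; apply/val_inj.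
  by rewrite /= /bump leqNgt ltn_ord.
move=> P; rewrite mmap_muni.
have -> : map_poly (mpoly.mmap (pemb E') (ppt E' \o x \o widen_ord (leqnSn n)))
    (mpoly.muni P) =
  map_poly phi (map_poly (mpoly.mmap (pemb E) (ppt E \o x')) (mpoly.muni P)).
  rewrite -map_poly_comp; apply: eq_map_poly => q /=.
  rewrite /mpoly.mmap rmorph_sum; apply: eq_bigr => m _.
  rewrite rmorphM phik; congr (_ * _); rewrite /mpoly.mmap1 rmorph_prod.
  apply: eq_bigr => i _; rewrite rmorphXn phip//.
  by rewrite inE sx; apply/orP; right; apply/existsP; exists i.
move=> /ind h; apply: muni_eq0; apply/polyP => i; rewrite coef0.
by apply: indE; have := congr1 (fun p : {poly _} => p`_i) h; rewrite coef_map coef0.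
Qed.

Lemma term_pt_indep n (x : 'I_n -> Y) : injective x -> (forall i, x i != o) ->
  forall P, mpoly.mmap term_const (term_pt \o x) P = 0 -> P = 0.
Proof.
move=> xinj xo P P0; have [s [E [uE sx]]] := universal_indep xinj xo; apply.
(* [rel a z] says that some term with points in [s] represents [a] and evaluates to [z]. It is
   compatible with sums and products, so it links the two evaluations of [P], and the vanishing of
   the first gives that of the second. *)
pose rel (a : Q) (z : pfield E) :=
  exists2 t, {subset tpoints t <= s} & a = pi t /\ z = teval E t.
have relD a b y z : rel a y -> rel b z -> rel (a + b) (y + z).
  move=> [t ts [-> ->]] [u us [-> ->]]; exists (TAdd t u).
    by move=> c /=; rewrite mem_cat => /orP[/ts|/us].
  by rewrite -[_ + _]/(tq_add _ _) pi_add.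
have relM a b y z : rel a y -> rel b z -> rel (a * b) (y * z).
  move=> [t ts [-> ->]] [u us [-> ->]]; exists (TMul t u).
    by move=> c /=; rewrite mem_cat => /orP[/ts|/us].
  by rewrite -[_ * _]/(tq_mul _ _) pi_mul.
have relC k : rel (term_const k) (pemb E k) by exists (@TConst K Y k).
have rel1 : rel 1 1 by rewrite -(rmorph1 (pemb E)); exact: relC.
have : rel (mpoly.mmap term_const (term_pt \o x) P)
           (mpoly.mmap (pemb E) (ppt E \o x) P).
  rewrite /mpoly.mmap; elim/big_ind2 : _ => [|a y b z|m _]; [|exact: relD|].
    by rewrite -(rmorph0 (pemb E)) -(rmorph0 term_const); exact: relC.
  apply: (relM); first exact: relC.
  rewrite /mpoly.mmap1; elim/big_ind2 : _ => [//|a y b z|i _]; first exact: relM.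
  elim: (m i) => [//|k IH]; rewrite !exprS; apply: (relM) => //.
  exists (@TPt K Y (x i)) => //= a; rewrite inE => /eqP ->.
  by rewrite sx; apply/existsP; exists i.
rewrite P0 => -[t ts [/esym/eqP]].
by rewrite -[0]/(const 0) (pi_termE uE)//= rmorph0 => /eqP -> ->.
Qed.

End free_extension.

(** * Completion of a valued field *)

Section completion.
Local Open Scope quotient_scope.
Context {R : realType} {K : fieldType} (v : valuation R K).
Implicit Types (f g : nat -> K) (M : R) (N : nat).

Definition eventually_ge f M :=
  exists N, forall n, (N <= n)%N -> (M%:E <= v (f n))%E.

Definition vcauchy f := forall M, exists N, forall m n,
  (N <= m)%N -> (N <= n)%N -> (M%:E <= v (f m - f n)%R)%E.

Definition vnull f := forall M, eventually_ge f M.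

Let geq_maxl N N' n : (maxn N N' <= n)%N -> (N <= n)%N.
Proof. by rewrite geq_max => /andP[]. Qed.

Let geq_maxr N N' n : (maxn N N' <= n)%N -> (N' <= n)%N.
Proof. by rewrite geq_max => /andP[]. Qed.

Lemma eventually_geD f g M : eventually_ge f M -> eventually_ge g M ->
  eventually_ge (f + g) M.
Proof.
move=> [N fN] [N' gN]; exists (maxn N N') => n nN.
apply: le_trans (valuationD v _ _); rewrite le_min.
by rewrite fN ?gN//; [exact: geq_maxr nN|exact: geq_maxl nN].
Qed.

Lemma eventually_geM f g M M' : eventually_ge f M -> eventually_ge g M' ->
  eventually_ge (f * g) (M + M').
Proof.
move=> [N fN] [N' gN]; exists (maxn N N') => n nN.
rewrite [v _]valuationM EFinD.
by rewrite leeD ?fN ?gN//; [exact: geq_maxl nN|exact: geq_maxr nN].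
Qed.

Lemma vcauchy_bounded f : vcauchy f -> exists M, eventually_ge f M.
Proof.
move=> /(_ 0)[N fN]; have : v (f N) != -oo%E by exact: valuation_gtNye.
have {}fN n : (N <= n)%N -> (0%:E <= v (f n - f N)%R)%E.
  by move=> nN; exact: fN.
case E : (v (f N)) => [r||]// _.
- exists (Num.min r 0), N => n /fN nN; rewrite -(subrK (f N) (f n)).
  apply: le_trans (valuationD v _ _); rewrite E le_min; apply/andP; split.
    by apply: le_trans nN; rewrite lee_fin ge_min lexx orbT.
  by rewrite lee_fin ge_min lexx.
- exists 0, N => n /fN nN; rewrite -(subrK (f N) (f n)).
  by apply: le_trans (valuationD v _ _); rewrite E le_min nN leey.
Qed.

Lemma vnullM f g : vnull f -> vcauchy g -> vnull (g * f).
Proof.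
move=> f0 /vcauchy_bounded[M gM] M'; rewrite -(subrKC M M').
exact: eventually_geM.
Qed.

Lemma vcauchyB f g : vcauchy f -> vcauchy g -> vcauchy (f - g).
Proof.
move=> cf cg M; have [N fN] := cf M; have [N' gN] := cg M.
exists (maxn N N') => m n mN nN.
have -> : (f - g) m - (f - g) n = (f m - f n) - (g m - g n).
  by rewrite !fctE !opprD !opprK addrACA.
apply: le_trans (valuationB v _ _); rewrite le_min fN ?gN//.
- exact: geq_maxr mN.
- exact: geq_maxr nN.
- exact: geq_maxl mN.
- exact: geq_maxl nN.
Qed.

Lemma vcauchyM f g : vcauchy f -> vcauchy g -> vcauchy (f * g).
Proof.
move=> cf cg M; have [B [N0 fB]] := vcauchy_bounded cf.
have [B' [N0' gB]] := vcauchy_bounded cg.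
(* The thresholds compensate for the lower bounds [B] on [f] and [B'] on [g], which may be
   negative. *)
have [N fN] := cf (M - B'); have [N' gN] := cg (M - B).
exists (maxn (maxn N0 N0') (maxn N N')) => m n mN nN.
have -> : (f * g) m - (f * g) n = f m * (g m - g n) + (f m - f n) * g n.
  by rewrite mulrBr mulrBl addrA subrK.
apply: le_trans (valuationD v _ _); rewrite !valuationM le_min; apply/andP; split.
  rewrite -(subrKC B M) EFinD leeD//.
    exact/fB/(geq_maxl (geq_maxl mN)).
  by apply: gN; [exact: geq_maxr (geq_maxr mN)|exact: geq_maxr (geq_maxr nN)].
rewrite -(subrK B' M) EFinD leeD//.
  by apply: fN; [exact: geq_maxl (geq_maxr mN)|exact: geq_maxl (geq_maxr nN)].
exact/gB/(geq_maxr (geq_maxl nN)).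
Qed.

Lemma vcauchy_cst k : vcauchy (cst k).
Proof. by move=> M; exists 0%N => m n _ _; rewrite subrr valuation0 leey. Qed.

Definition vcauchy_pred : {pred nat -> K} := fun f => `[< vcauchy f >].

Lemma vcauchy_closed : subring_closed vcauchy_pred.
Proof.
split; rewrite ?unfold_in.
- by apply/asboolP; exact: vcauchy_cst.
- move=> f g; rewrite !unfold_in => /asboolP cf /asboolP cg.
  by apply/asboolP; exact: vcauchyB.
- move=> f g; rewrite !unfold_in => /asboolP cf /asboolP cg.
  by apply/asboolP; exact: vcauchyM.
Qed.

HB.instance Definition _ := GRing.isSubringClosed.Build (nat -> K) vcauchy_pred
  vcauchy_closed.

Record vcauchy_seq := VcauchySeq {
  vcauchy_seq_val :> nat -> K ;
  vcauchy_seqP : vcauchy_seq_val \in vcauchy_pred }.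

HB.instance Definition _ := [isSub for vcauchy_seq_val].
HB.instance Definition _ := [Choice of vcauchy_seq by <:].
HB.instance Definition _ :=
  [SubChoice_isSubComNzRing of vcauchy_seq by <:].

Lemma vcauchy_seq_cauchy (f : vcauchy_seq) : vcauchy f.
Proof. by have := vcauchy_seqP f; rewrite unfold_in => /asboolP. Qed.

Definition null_ideal : {pred vcauchy_seq} := fun h => `[< vnull (val h) >].

Lemma null_ideal_closed : idealr_closed null_ideal.
Proof.
split; rewrite ?unfold_in/=.
- by apply/asboolP => M; exists 0%N => n _; rewrite valuation0 leey.
- apply/asboolP => /(_ 1)[N /(_ N (leqnn N))].
  by rewrite valuation1 lee_fin ler10.
- move=> a f g; rewrite !unfold_in => /asboolP f0 /asboolP g0.
  apply/asboolP => M; apply: eventually_geD; last exact: g0.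
  by move: M; apply: vnullM => //; exact: vcauchy_seq_cauchy.
Qed.

HB.instance Definition _ := isIdealr.Build vcauchy_seq null_ideal
  null_ideal_closed.

Definition completion := {ideal_quot null_ideal}.

HB.instance Definition _ := GRing.ComNzRing.on completion.

Local Notation pi := (\pi_completion).

Let piD (f g : vcauchy_seq) : pi (f + g) = pi f + pi g :> completion.
Proof. exact: rmorphD. Qed.

Let piB (f g : vcauchy_seq) : pi (f - g) = pi f - pi g :> completion.
Proof. exact: rmorphB. Qed.

Let piM (f g : vcauchy_seq) : pi (f * g) = pi f * pi g :> completion.
Proof. exact: rmorphM. Qed.

Let pi1 : pi 1 = 1 :> completion.
Proof. exact: rmorph1. Qed.

Let pi_eq0 (f : vcauchy_seq) :
  (pi f == 0 :> completion) = (f \in null_ideal).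
Proof.
have <- : pi 0 = 0 :> completion by exact: rmorph0.
by rewrite -(Quotient.idealrBE null_ideal) subr0.
Qed.

Let pi_eq0P (f : vcauchy_seq) : pi f = 0 :> completion <-> vnull f.
Proof.
split=> [/eqP|f0]; first by rewrite pi_eq0 unfold_in => /asboolP.
by apply/eqP; rewrite pi_eq0 unfold_in; exact/asboolP.
Qed.

Let to_seq f (cf : vcauchy f) : vcauchy_seq :=
  @VcauchySeq f (introT (asboolP _) cf).

Definition stationary f (r : R) :=
  exists N, forall n, (N <= n)%N -> v (f n) = r%:E.

(** If v(f n) < M while all later terms differ from f n by elements of value at least M, the strict
    case of the ultrametric inequality freezes the value at v(f n). *)
Lemma vcauchy_stationary f : vcauchy f -> ~ vnull f -> exists r, stationary f r.
Proof.
move=> cf /existsNP[M nM]; have [N fN] := cf M.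
have [n [Nn fn]] : exists n, (N <= n)%N /\ (v (f n) < M%:E)%E.
  apply: contrapT => h; apply: nM; exists N => n Nn.
  by rewrite leNgt; apply/negP => fn; apply: h; exists n.
have /(valuation_fin v)[r fr] : f n != 0.
  by apply: contraTneq fn => ->; rewrite valuation0 -leNgt leey.
exists r, N => m Nm; rewrite -(subrKC (f n) (f m)) valuationDl//.
exact: lt_le_trans fn (fN _ _ Nm Nn).
Qed.

Let stationary_eq f g r : vnull (f - g) -> stationary f r -> stationary g r.
Proof.
move=> /(_ (r + 1))[N fN] [N' fr]; exists (maxn N N') => n nN.
have fn := fr _ (geq_maxr nN); rewrite -[RHS]fn.
have -> : g n = f n + (- (f n - g n)) by rewrite opprB addrC subrK.
rewrite valuationDl// valuationN fn.
apply: lt_le_trans (fN _ (geq_maxl nN)).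
by rewrite lte_fin ltrDl.
Qed.

Let stationary_uniq f r s : stationary f r -> stationary f s -> r = s.
Proof.
move=> [N fr] [N' fs]; have := fr (maxn N N') (leq_maxl _ _).
by rewrite fs ?leq_maxr// => -[].
Qed.

Let stationary_nnull f r : stationary f r -> ~ vnull f.
Proof.
move=> [N fr] /(_ (r + 1))[N' fN]; have := fN (maxn N N') (leq_maxr _ _).
by rewrite fr ?leq_maxl// lee_fin leNgt ltrDl ltr01.
Qed.

(** The value of a nonzero class is the eventual value of a representing sequence; it is independent
    of the sequence, because a null perturbation is eventually of larger value. *)
Let completion_val_ex (a : completion) : exists x : \bar R,
  (a = 0 /\ x = +oo%E) \/ exists2 r, stationary (repr a) r & x = r%:E.
Proof.
have [->|a0] := eqVneq a 0; first by exists +oo%E; left.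
have [||r ar] := @vcauchy_stationary (repr a).
- exact: vcauchy_seq_cauchy.
- by move/pi_eq0P; rewrite reprK => /eqP; rewrite (negbTE a0).
- by exists r%:E; right; exists r.
Qed.

Definition completion_val (a : completion) : \bar R := sval (cid (completion_val_ex a)).

Let completion_valP a : (a = 0 /\ completion_val a = +oo%E) \/
  exists2 r, stationary (repr a) r & completion_val a = r%:E.
Proof. exact: (svalP (cid (completion_val_ex a))). Qed.

Lemma completion_val_pi (f : vcauchy_seq) r : stationary f r ->
  completion_val (pi f) = r%:E.
Proof.
move=> fr; have [[/pi_eq0P f0 _]|[s fs ->]] := completion_valP (pi f).
  by case: (stationary_nnull fr).
congr EFin; apply: stationary_uniq fr; apply: stationary_eq fs.
by apply/(pi_eq0P (repr (pi f) - f)); rewrite piB reprK subrr.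
Qed.

Let completion_val0 : completion_val 0 = +oo%E.
Proof.
have [[_ ->]//|[r /stationary_nnull f0]] := completion_valP 0.
by case: f0; apply/pi_eq0P; rewrite reprK.
Qed.

Let completionP (a : completion) : a = 0 \/
  exists (f : vcauchy_seq) r, a = pi f /\ stationary f r.
Proof.
have [->|a0] := eqVneq a 0; [by left|right].
have [[/eqP]|[r ar _]] := completion_valP a; first by rewrite (negbTE a0).
by exists (repr a), r; rewrite reprK.
Qed.

Let completion_valNy a : completion_val a != -oo%E.
Proof. by have [[_ ->]|[r _ ->]] := completion_valP a. Qed.

Let completion_valy a : completion_val a = +oo%E <-> a = 0.
Proof.
split=> [|->]; last exact: completion_val0.
by have [[]|[r _ ->]] := completion_valP a.
Qed.

Let completion_valM a b :
  completion_val (a * b) = (completion_val a + completion_val b)%E.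
Proof.
have [->|[f [r [-> fr]]]] := completionP a.
  by rewrite mul0r completion_val0 addye.
have [->|[g [s [-> gs]]]] := completionP b.
  by rewrite mulr0 completion_val0 addey.
rewrite -piM (completion_val_pi fr) (completion_val_pi gs).
apply: completion_val_pi; case: fr gs => [N fr] [N' gs].
exists (maxn N N') => n nN; rewrite [v _]valuationM fr ?gs//.
- exact: geq_maxr nN.
- exact: geq_maxl nN.
Qed.

Lemma completion_val_ge (f : vcauchy_seq) M : eventually_ge f M ->
  (M%:E <= completion_val (pi f))%E.
Proof.
move=> [N fM]; have [->|f0] := eqVneq (pi f : completion) 0.
  by rewrite completion_val0 leey.
have [||r fr] := @vcauchy_stationary f; first exact: vcauchy_seq_cauchy.
  by move/pi_eq0P/eqP; rewrite (negbTE f0).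
rewrite (completion_val_pi fr); case: fr => N' fr.
by rewrite -(fr (maxn N N') (leq_maxr _ _)) fM// leq_maxl.
Qed.

Let completion_valD a b :
  (Order.min (completion_val a) (completion_val b) <= completion_val (a + b)%R)%E.
Proof.
have [->|[f [r [-> fr]]]] := completionP a; first by rewrite add0r ge_min lexx orbT.
have [->|[g [s [-> gs]]]] := completionP b; first by rewrite addr0 ge_min lexx.
rewrite -piD (completion_val_pi fr) (completion_val_pi gs) -EFin_min.
apply: completion_val_ge; apply: eventually_geD.
- by case: fr => N fr; exists N => n /fr ->; rewrite lee_fin ge_min lexx.
- by case: gs => N gs; exists N => n /gs ->; rewrite lee_fin ge_min lexx orbT.
Qed.

Let completion_inv_ex (a : completion) : exists b : completion,
  (a != 0 -> b * a = 1) /\ (a = 0 -> b = 0).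
Proof.
have [a0|[f [r [af fr]]]] := completionP a; first by exists 0; rewrite a0 eqxx.
have cf := vcauchy_seq_cauchy f.
have [N fN] := fr.
have f0 n : (N <= n)%N -> f n != 0.
  by move=> /fN; apply: contra_eq_neq => ->; rewrite valuation0.
have cg : vcauchy (fun n => (f n)^-1).
  (* The difference of two inverses has the value of f n - f m minus 2r, once both terms have value
     [r]. *)
  move=> M; have [N' fN'] := cf (M + r *+ 2).
  exists (maxn N N') => m n mN nN.
  have -> : (f m)^-1 - (f n)^-1 = (f n - f m) / (f m * f n).
    rewrite -[(f m)^-1]mul1r -[(f n)^-1]mul1r -mulNr.
    by rewrite addf_div ?f0 ?(geq_maxl nN) ?(geq_maxl mN)// mulN1r mul1r.
  rewrite valuation_div ?mulf_neq0 ?f0 ?(geq_maxl nN) ?(geq_maxl mN)//.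
  rewrite valuationM !fN ?(geq_maxl nN) ?(geq_maxl mN)// -EFinD.
  by rewrite leeBrDr// -EFinD fN' ?(geq_maxr nN) ?(geq_maxr mN).
exists (pi (to_seq cg)); split=> [_|a0]; last first.
  by move: a0; rewrite af => /pi_eq0P f0'; case: (stationary_nnull fr).
rewrite af -piM; apply/eqP; rewrite -subr_eq0 -pi1 -piB.
apply/eqP/pi_eq0P => M; exists N => n nN.
have -> : (to_seq cg * f - 1 : vcauchy_seq) n = (f n)^-1 * f n - 1 by [].
by rewrite mulVf ?f0// subrr valuation0 leey.
Qed.

Definition completion_inv a : completion := sval (cid (completion_inv_ex a)).

Let completion_mulVf a : a != 0 -> completion_inv a * a = 1.
Proof. by rewrite /completion_inv; case: cid => b []. Qed.

Let completion_inv0 : completion_inv 0 = 0.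
Proof. by rewrite /completion_inv; case: cid => b [_] /= ->. Qed.

HB.instance Definition _ :=
  GRing.ComNzRing_isField.Build completion completion_mulVf completion_inv0.

Definition completion_valuation : valuation R completion :=
  Valuation completion_valNy completion_valy completion_valM completion_valD.

Definition completion_embed (k : K) : completion := pi (to_seq (vcauchy_cst k)).

Let completion_embed_zmod_morphism : zmod_morphism completion_embed.
Proof.
move=> x y; rewrite /completion_embed -piB; congr pi; exact: val_inj.
Qed.

Let completion_embed_monoid_morphism : monoid_morphism completion_embed.
Proof.
split=> [|x y]; rewrite /completion_embed -?piM -?pi1; congr pi;
  exact: val_inj.
Qed.

HB.instance Definition _ := GRing.isZmodMorphism.Build K completion
  completion_embed completion_embed_zmod_morphism.
HB.instance Definition _ := GRing.isMonoidMorphism.Build K completion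
  completion_embed completion_embed_monoid_morphism.

Lemma completion_valuation_embed :
  valued_extension v completion_valuation completion_embed.
Proof.
move=> k; have [->|/(valuation_fin v)[r kr]] := eqVneq k 0.
  by rewrite rmorph0 !valuation0.
by rewrite kr; apply: completion_val_pi; exists 0%N.
Qed.

(** The value of a nonzero limit is already the value of a late term, so completing creates no new
    value. *)
Lemma completion_valuation_range : range completion_valuation `<=` range v.
Proof.
move=> _ [a _ <-]; have [->|[f [r [-> [N fr]]]]] := completionP a.
  by exists 0 => //; rewrite !valuation0.
by exists (f N) => //; rewrite fr// [RHS](@completion_val_pi _ r)//; exists N.
Qed.

Lemma completion_limit f : vcauchy f -> exists z : completion, forall M,
  exists N, forall n, (N <= n)%N ->
    (M%:E <= completion_valuation (completion_embed (f n) - z)%R)%E.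
Proof.
move=> cf; exists (pi (to_seq cf)) => M; have [N fN] := cf M.
exists N => n nN; rewrite -piB; apply: completion_val_ge.
by exists N => m mN; exact: fN.
Qed.

Lemma completion_dense (z : completion) M : exists k,
  (M%:E <= completion_valuation (completion_embed k - z)%R)%E.
Proof.
elim/quotW : z => f; have [N fN] := vcauchy_seq_cauchy f M.
exists (f N); rewrite -piB; apply: completion_val_ge.
by exists N => m mN; exact: fN.
Qed.

End completion.

(** * Metric properties *)

Section expeN_theory.
Context {R : realType} (eta : R) (eta_gt1 : 1 < eta).

Lemma expeN_lt (a b : \bar R) : (a < b)%E -> a != -oo%E ->
  expeN eta b < expeN eta a.
Proof.
have eta_gt0 : 0 < eta by exact: lt_trans eta_gt1.
case: a b => [r| |] [s| |]//=; last by rewrite powR_gt0.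
rewrite lte_fin => rs _; rewrite /powR gt_eqF// ltr_expR ltr_pM2r ?ln_gt0//.
by rewrite ltrN2.
Qed.

Lemma expeN_le (a b : \bar R) : b != -oo%E ->
  (expeN eta b <= expeN eta a) -> (a <= b)%E.
Proof.
by move=> b0; rewrite leNgt => h; rewrite leNgt; apply: contra h => /expeN_lt->.
Qed.

Lemma expeN_inj (a b : \bar R) : a != -oo%E -> b != -oo%E ->
  expeN eta a = expeN eta b -> a = b.
Proof.
by move=> a0 b0 ab; apply/eqP; rewrite eq_le !expeN_le// ab.
Qed.

Lemma expeN_surj (eps : R) : 0 < eps -> exists M : R, expeN eta M%:E = eps.
Proof.
move=> eps0; exists (- (ln eps / ln eta)) => /=.
have eta_gt0 : 0 < eta by exact: lt_trans eta_gt1.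
rewrite opprK /powR gt_eqF// divfK ?gt_eqF ?ln_gt0//.
by rewrite lnK.
Qed.

End expeN_theory.

Lemma adjoin_infty_neqNy (R : realType) (G : {pred R}) (a : \bar R) :
  adjoin_infty G a -> a != -oo%E.
Proof. by case=> [[r _ <-]|->]. Qed.

(** As eta > 1, [expeN eta] is injective and strictly decreasing away from [-oo], so the metric
    axioms pass to exponents picked by choice. *)
Lemma log_ultrametric_metric (R : realType) (eta : R) (eta_gt1 : 1 < eta)
    (G : {pred R}) (X : metricType R) :
  ultrametric X -> metric_valued_in (expeN eta @` adjoin_infty G) X ->
  exists e : X -> X -> \bar R, log_ultrametric G e /\
    forall x y, mdist x y = expeN eta (e x y).
Proof.
move=> Xu XG.
have /choice[e he] : forall xy : X * X, exists a, adjoin_infty G a /\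
    expeN eta a = mdist xy.1 xy.2.
  by move=> [x y]; have [a aG] := XG x y; exists a.
have eG x y := (he (x, y)).1.
have ed x y : expeN eta (e (x, y)) = mdist x y by rewrite (he (x, y)).2.
have eN x y := adjoin_infty_neqNy (eG x y).
exists (fun x y => e (x, y)); split; last by move=> x y; rewrite ed.
split.
- by move=> x; apply: (expeN_inj eta_gt1) => //; rewrite ed/= mdistxx.
- move=> x y xy; have [[r rG <-]|] := eG x y; first by exists r.
  move=> E; have := ed x y; rewrite E /= => /esym/mdist_positivity/eqP.
  by rewrite (negbTE xy).
- by move=> x y; apply: (expeN_inj eta_gt1) => //; rewrite !ed/= metric_sym.
- move=> x y z; have := Xu x z y; rewrite le_max ge_min -!ed.
  by case/orP => /(expeN_le eta_gt1) ->//; rewrite orbT.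
Qed.

Lemma isometric_complete_closed (R : realType) (X Y : metricType R) (f : X -> Y) :
  isometric_embedding f -> complete_space X -> closed (range f).
Proof.
move=> fi cX p cp.
have near_p e : 0 < e -> exists x, mdist p (f x) < e.
  move=> e0; have [_ [[x _ <-]]] := cp _ (nbhsx_ballx p e e0).
  by rewrite ballEmdist/=; exists x.
(* If [p] adheres to the image, the sets of points of [X] whose images are close to [p] generate a
   proper Cauchy filter; its limit must be sent to [p]. *)
pose F := filter_from [set e : R | 0 < e] (fun e => [set x | mdist p (f x) < e]).
have FF : ProperFilter F.
  apply: filter_from_proper; last by move=> e /near_p.
  apply: filter_from_filter; first by exists 1 => /=.
  move=> e e' e0 e'0; exists (Num.min e e'); first by rewrite /= lt_min e0.
  by move=> x /=; rewrite lt_min => /andP[].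
have /(cX F)[l Fl] : cauchy F.
  apply: cauchy_exP => e e0; have e20 : 0 < e / 2 by rewrite divr_gt0.
  have [x px] := near_p _ e20; exists x, (e / 2) => // y /= py.
  rewrite ballEmdist/= -fi (le_lt_trans (metric_triangle _ p _))//.
  by rewrite (splitr e) ltrD// metric_sym.
exists l => //; apply/esym/mdist_positivity/eqP.
rewrite eq_le mdist_ge0 andbT leNgt; apply/negP => d0.
have d20 : 0 < mdist p (f l) / 2 by rewrite divr_gt0.
have [e e0 he] := Fl _ (nbhsx_ballx l _ d20).
have [|x] := near_p (Num.min e (mdist p (f l) / 2)); first by rewrite lt_min e0.
rewrite lt_min => /andP[/he + px]; rewrite ballEmdist/= -fi => lx.
have := metric_triangle p (f x) (f l).
by rewrite leNgt [ltRHS]splitr ltrD// metric_sym.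
Qed.

Section valued_metric_theory.
Context {R : realType} (eta : R) (eta_gt1 : 1 < eta).
Context {K : fieldType} (v : valuation R K).
Local Notation M := (vmetric v eta_gt1).

Lemma mdist_vmetric (x y : M) :
  mdist x y = expeN eta (v ((x : K) - (y : K))).
Proof. by []. Qed.

Lemma vball_le (x y : M) (r : R) :
  ball x (expeN eta r%:E) y -> (r%:E <= v ((x : K) - (y : K))%R)%E.
Proof.
rewrite ballEmdist/= => h; apply: (expeN_le eta_gt1); last exact: ltW.
exact: valuation_gtNye.
Qed.

Lemma vball_lt (x y : M) (r : R) :
  (r%:E < v ((x : K) - (y : K))%R)%E -> ball x (expeN eta r%:E) y.
Proof. by move=> h; rewrite ballEmdist; exact: expeN_lt. Qed.

(** When the values of f - I x are bounded by r, the ball of radius eta^-(r+1) around [f] misses the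
    image, so [f] is not in the closure. *)
Lemma bounded_closed (X : Type) (I : X -> M) :
  (forall f : M, (exists x, f = I x) \/
     exists r : R, forall x, (v ((f : K) - (I x : K))%R <= r%:E)%E) ->
  closed (range I).
Proof.
move=> bI f cf; have [[x ->]|[r fr]] := bI f; first by exists x.
have e0 : 0 < expeN eta (r + 1)%:E by rewrite powR_gt0// (lt_trans _ eta_gt1).
have [_ [[x _ <-] /vball_le h]] := cf _ (nbhsx_ballx f _ e0).
by have := le_trans h (fr x); rewrite lee_fin leNgt ltrDl ltr01.
Qed.

End valued_metric_theory.

(** A Cauchy filter contains balls of radius eta^-n, and by density their centres can be
    approximated in [K] to the same precision. The resulting sequence of [K] is Cauchy, and its
    limit is a limit of the filter: sequences thus suffice against arbitrary filters. *)
Lemma completion_complete (R : realType) (eta : R) (eta_gt1 : 1 < eta)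
    (K : fieldType) (v : valuation R K) :
  complete_space (vmetric (completion_valuation v) eta_gt1).
Proof.
set w := completion_valuation v; set phi := @completion_embed _ _ v.
move=> F PF /cauchyP Fc.
have ball_near n : exists k : K, exists2 x : vmetric w eta_gt1,
    F (ball x (expeN eta n%:R%:E)) & (n%:R%:E <= w (phi k - x)%R)%E.
  have [|x Fx] := Fc (expeN eta n%:R%:E).
    by rewrite powR_gt0// (lt_trans _ eta_gt1).
  by have [k kx] := completion_dense x n%:R; exists k, x.
have /choice[k hk] := ball_near.
have kF n m : (n <= m)%N -> F [set y | (n%:R%:E <= w (phi (k m) - y)%R)%E].
  move=> nm; have [x Fx kx] := hk m.
  apply: filterS Fx => y /= /vball_le xy.
  have -> : phi (k m) - y = (phi (k m) - x) + ((x : completion v) - y).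
    by rewrite addrA subrK.
  apply: le_trans (valuationD w _ _); apply: (@le_trans _ _ m%:R%:E).
    by rewrite lee_fin ler_nat.
  by rewrite le_min kx xy.
have ex_nat (M : R) : exists N : nat, M <= N%:R.
  exists (Num.bound `|M|); apply: le_trans (ler_norm M) _.
  exact/ltW/archi_boundP.
have ck : vcauchy v k.
  move=> M; have [N MN] := ex_nat M; exists N => m n mN nN.
  have [y [hm hn]] := filter_ex (filterI (kF _ _ mN) (kF _ _ nN)).
  have -> : v (k m - k n) = w ((phi (k m) - y) - (phi (k n) - y)).
    rewrite opprB addrA subrK -rmorphB.
    exact/esym/(completion_valuation_embed v).
  apply: le_trans (valuationB w _ _); apply: (@le_trans _ _ N%:R%:E).
    by rewrite lee_fin.
  by rewrite le_min hm hn.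
have [z kz] := completion_limit ck; exists z.
apply/fcvg_ballP => eps /(expeN_surj eta_gt1)[M <-].
(* One more than [M], because the balls are open and require a strict inequality. *)
have [N hN] := kz (M + 1); have [N' MN'] := ex_nat (M + 1).
have := kF N' (maxn N N') (leq_maxr _ _).
apply: filterS => y /= hy; apply: vball_lt.
apply: (@lt_le_trans _ _ (M + 1)%:E); first by rewrite lte_fin ltrDl.
have -> : (z : completion v) - y =
    (phi (k (maxn N N')) - y) - (phi (k (maxn N N')) - z).
  by rewrite opprB [RHS]addrC addrA subrK.
apply: le_trans (valuationB w _ _); rewrite le_min hN ?leq_maxl// andbT.
by apply: le_trans hy; rewrite lee_fin.
Qed.

(** * Gluing ultrametrics *)

Section log_ultrametric_constructions.
Context {R : realType} (G : zmodClosed R).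

Lemma log_ultra_minG (X : eqType) (e : X -> X -> \bar R) a b r :
  log_ultrametric G e -> r \in G ->
  exists2 s, s \in G & Order.min (e a b) r%:E = s%:E.
Proof.
move=> eU rG; have [->|/(log_ultra_neq eU)[s sG ->]] := eqVneq a b.
  by exists r => //; rewrite (log_ultraxx eU) min_r// leey.
by rewrite -EFin_min minEle; case: ifP => _; [exists s|exists r].
Qed.

(** The new point [None] is put at distance max(d(x, x0), 1) from x, for a fixed x0. The cap keeps
    it away from x0 itself, and its exponent 0 belongs to every [G]. *)
Lemma log_ultrametric_option (X : eqType) (e : X -> X -> \bar R) :
  log_ultrametric G e -> exists e' : option X -> option X -> \bar R,
    [/\ log_ultrametric G e', forall x y, e' (Some x) (Some y) = e x y
      & forall x, (e' None (Some x) <= 0)%E].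
Proof.
move=> eU; have [[x0 _]|X0] := pselect (exists x : X, True); last first.
  exists (fun _ _ => +oo%E); split => [|x|x]; try by case: X0; exists x.
  by split=> // [[x|] [y|]]// _; case: X0; [exists x..|exists y].
pose rho x := Order.min (e x x0) 0%E.
have rho_le x y : (Order.min (rho x) (e x y) <= rho y)%E.
  rewrite /rho le_min !ge_min lexx !orbT andbT.
  have := log_ultra_min eU y x x0; rewrite (log_ultraC eU y) ge_min.
  by case/orP => ->//; rewrite orbT.
have rho_min x y : (Order.min (rho x) (rho y) <= e x y)%E.
  have := log_ultra_min eU x x0 y; rewrite (log_ultraC eU x0) /rho !ge_min.
  by case/orP => ->//; rewrite orbT.
exists (fun a b => match a, b with
  | Some x, Some y => e x y | Some x, None => rho x
  | None, Some y => rho y | None, None => +oo%E end).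
split=> //; last by move=> x; rewrite ge_min lexx orbT.
split.
- by move=> [x|]//; exact: log_ultraxx eU _.
- move=> [x|] [y|]//= xy.
  + by apply: (log_ultra_neq eU); apply: contraNneq xy => ->.
  + exact: (log_ultra_minG _ _ eU (rpred0 G)).
  + exact: (log_ultra_minG _ _ eU (rpred0 G)).
- by move=> [x|] [y|]//; exact: log_ultraC eU _ _.
- move=> [x|] [y|] [z|] //; rewrite ?leey//.
  + exact: log_ultra_min eU _ _ _.
  + by rewrite minC (log_ultraC eU).
  + by rewrite ge_min lexx.
  + by rewrite ge_min lexx orbT.
Qed.

(* With Z = option X and o = None, this extends an ultrametric from a subset X
   of U to U. *)
Lemma log_ultrametric_pullback (Z U : eqType) (e : Z -> Z -> \bar R) (o : Z)
    (h : U -> Z) :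
  log_ultrametric G e -> (forall z, z != o -> (e o z <= 0)%E) ->
  (forall a b, a != b -> h a = h b -> h a = o) ->
  exists e' : U -> U -> \bar R,
    log_ultrametric G e' /\ forall a b, h a != o -> e' a b = e (h a) (h b).
Proof.
move=> eU e0 hinj.
exists (fun a b => if a == b then +oo%E else
  if h a == h b then 0%E else e (h a) (h b)); split; last first.
  move=> a b hao; case: eqVneq => [->|ab]; first by rewrite (log_ultraxx eU).
  by case: eqVneq => // /(hinj _ _ ab)/eqP; rewrite (negbTE hao).
split.
- by move=> a; rewrite eqxx.
- move=> a b ab; rewrite (negbTE ab); case: eqVneq => [_|hab].
    by exists 0 => //; exact: rpred0.
  exact: (log_ultra_neq eU).
- by move=> a b; rewrite eq_sym [h a == _]eq_sym (log_ultraC eU).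
move=> a b c; have [->|ab] := eqVneq a b; first by rewrite ge_min lexx orbT.
have [bc|bc] := eqVneq b c; first by rewrite -bc (negbTE ab) ge_min lexx.
have [->|ac] := eqVneq a c; first by rewrite leey.
have [hac|hac] := eqVneq (h a) (h c).
  rewrite ge_min; have [_|hab] := eqVneq (h a) (h b); first by rewrite lexx.
  (* Here [a] and [c] both lie over [o] and have mutual exponent 0, while [e0] bounds by 0 the
     exponent between [o] and [h b]. *)
  by rewrite (hinj _ _ ac hac) e0// -(hinj _ _ ac hac) eq_sym.
have [<-|hab] := eqVneq (h a) (h b); first by rewrite (negbTE hac) ge_min lexx orbT.
have [->|hbc] := eqVneq (h b) (h c); first by rewrite ge_min lexx.
exact: log_ultra_min eU _ _ _.
Qed.

(** Provides, for each [g] in [G], a space where [g] occurs as an exponent; every element of [G]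
    becomes in this way a value of the universal field. *)
Lemma log_ultrametric_discrete (U : eqType) (g : R) : g \in G ->
  log_ultrametric G (fun a b : U => if a == b then +oo%E else g%:E).
Proof.
move=> gG; split.
- by move=> a; rewrite eqxx.
- by move=> a b /negbTE ->; exists g.
- by move=> a b; rewrite eq_sym.
- move=> a b c; have [->|ab] := eqVneq a b; first by rewrite ge_min lexx orbT.
  by rewrite ge_min; case: (eqVneq a c) => _; rewrite ?leey ?lexx.
Qed.

(** Two points of different components are at the larger of their distances to [b] in their own
    components, and at least at distance 1, so that the copies of [b] stay apart. *)
Lemma log_ultrametric_glue (S U : eqType) (E : S -> U -> U -> \bar R) (b : U) :
  (forall s, log_ultrametric G (E s)) ->
  exists e : S * U -> S * U -> \bar R, log_ultrametric G e /\
    forall s x y, e (s, x) (s, y) = E s x y.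
Proof.
move=> EU; pose rho s x := Order.min (E s x b) 0%E.
have rho_le s x y : (Order.min (rho s x) (E s x y) <= rho s y)%E.
  rewrite /rho le_min !ge_min lexx !orbT andbT.
  have := log_ultra_min (EU s) y x b; rewrite (log_ultraC (EU s) y) ge_min.
  by case/orP => ->//; rewrite orbT.
have rho_min s x y : (Order.min (rho s x) (rho s y) <= E s x y)%E.
  have := log_ultra_min (EU s) x b y; rewrite (log_ultraC (EU s) b) /rho !ge_min.
  by case/orP => ->//; rewrite orbT.
have rhoG s x : exists2 p, p \in G & rho s x = p%:E.
  exact: (log_ultra_minG x b (EU s) (rpred0 G)).
(* From here [rho] is known only by its values in [G] and by the ultrametric inequalities in
   triangles having the base point as a vertex. *)
clearbody rho.
exists (fun p q => if p.1 == q.1 then E p.1 p.2 q.2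
  else Order.min (rho p.1 p.2) (rho q.1 q.2)); split; last first.
  by move=> s x y /=; rewrite eqxx.
split.
- by move=> [s x]; rewrite eqxx (log_ultraxx (EU s)).
- move=> [s x] [t y] /=; case: (eqVneq s t) => [<- xy|_ _].
    by apply: (log_ultra_neq (EU s)); apply: contraNneq xy => ->.
  have [p pG ->] := rhoG s x; have [q qG ->] := rhoG t y.
  by rewrite -EFin_min minEle; case: ifP => _; [exists p|exists q].
- move=> [s x] [t y] /=; rewrite eq_sym; case: eqVneq => [->|_].
    exact: log_ultraC (EU s) _ _.
  by rewrite minC.
- move=> [s x] [t y] [u z] /=.
  have [<-|st] := eqVneq s t; have [su|su] := eqVneq s u.
  + exact: log_ultra_min (EU s) _ _ _.
  + rewrite le_min; apply/andP; split; last by rewrite !ge_min lexx !orbT.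
    apply: le_trans (rho_le s y x); rewrite le_min !ge_min lexx !orbT/=.
    by rewrite (log_ultraC (EU s)) lexx.
  + rewrite -su eq_sym (negbTE st); apply: le_trans (rho_min s x z).
    by rewrite le_min !ge_min !lexx !orbT.
  + rewrite le_min; apply/andP; split; first by rewrite !ge_min lexx.
    case: eqVneq => [<-|_]; last by rewrite !ge_min lexx !orbT.
    by apply: le_trans (rho_le t y z); rewrite le_min !ge_min !lexx !orbT.
Qed.

End log_ultrametric_constructions.

(** * The extensions required by the theorem *)

Lemma exists_free_extension (R : realType) (G : zmodClosed R) (K : fieldType)
    (v : valuation R K) (X : eqType) (e : X -> X -> \bar R) :
  range v `<=` adjoin_infty G -> log_ultrametric G e ->
  exists (F : fieldType) (u : valuation R F) (iota : {rmorphism K -> F})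
         (I : X -> F),
    [/\ valued_extension v u iota, range u `<=` adjoin_infty G,
        forall x y, u (I x - I y) = e x y,
        algebraically_independent iota (range I)
      & forall f, (exists x, f = I x) \/
          exists M : R, forall x, (u (f - I x)%R <= M%:E)%E].
Proof.
move=> vG /log_ultrametric_option[e' [eU eE e0]].
exists (term_field None vG eU), (term_valuation None vG eU).
exists (term_const None vG eU), (term_pt None vG eU \o Some); split.
- exact: term_valuation_const.
- exact: term_valuation_range.
- by move=> x y; rewrite [LHS]term_valuation_pt eE.
- move=> n x xinj xI P.
  have /choice[y yx] : forall i, exists y, term_pt None vG eU (Some y) = x i.
    by move=> i; have [y _ <-] := xI i; exists y.
  have -> : x = term_pt None vG eU \o (Some \o y).
    by apply/funext => i; rewrite /= yx.
  apply: term_pt_indep => // i j [yij]; apply: xinj.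
  by rewrite -!yx yij.
- move=> f; have [[[x|] ->]|[M fM]] := term_valuation_bounded f.
  + by left; exists x.
  (* This [f] is the base point, that is 0, and its exponents to the points of [X] are at most 0. *)
  + by right; exists 0 => x; rewrite [leLHS]term_valuation_pt.
  + by right; exists M => x; exact: fM.
Qed.

Lemma algebraically_independent_comp (K F L : fieldType)
    (iota : {rmorphism K -> F}) (phi : {rmorphism F -> L}) (X : Type) (I : X -> F) :
  algebraically_independent iota (range I) ->
  algebraically_independent (phi \o iota) (range (phi \o I)).
Proof.
move=> indI n x xinj xI P.
have /choice[y yx] : forall i, exists y, phi (I y) = x i.
  by move=> i; have [y _ <-] := xI i; exists y.
have -> : mpoly.mmap (phi \o iota) x P = phi (mpoly.mmap iota (I \o y) P).
  rewrite /mpoly.mmap rmorph_sum; apply: eq_bigr => m _.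
  rewrite rmorphM /mpoly.mmap1 rmorph_prod; congr (_ * _).
  by apply: eq_bigr => i _; rewrite rmorphXn /= yx.
move=> /eqP; rewrite fmorph_eq0 => /eqP; apply: indI => [i j /= yij|i].
  by apply: xinj; rewrite -!yx yij.
by exists (y i).
Qed.

Lemma algebraically_independent_sub (K L : fieldType)
    (iota : {rmorphism K -> L}) (S T : set L) : S `<=` T ->
  algebraically_independent iota T -> algebraically_independent iota S.
Proof. by move=> ST indT n x xinj xS; apply: indT => // i; exact/ST/xS. Qed.

Lemma exists_universal_extension (R : realType) (eta : R) (eta_gt1 : 1 < eta)
    (kappa : Type) (G : zmodClosed R) (K : fieldType) (v : valuation R K) :
  range v `<=` adjoin_infty G ->
  exists (L : fieldType) (w : valuation R L) (iota : {rmorphism K -> L}),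
    [/\ valued_extension v w iota,
        range w = adjoin_infty G
      & forall X : metricType R,
          ultrametric X ->
          metric_valued_in (expeN eta @` adjoin_infty G) X ->
          [set: X] = set0 \/ [set: option X] #<= [set: kappa] ->
          exists I : X -> vmetric w eta_gt1,
            isometric_embedding I /\
            algebraically_independent iota (range I)].
Proof.
(* The two extra points of [bool] make [U] contain a base point and a pair of distinct points
   whatever [kappa] is. The index set [S] consists of all [G]-valued ultrametrics on [U]. *)
move=> vG; pose U := {classic (kappa + bool)%type}.
pose S := {classic {E : U -> U -> \bar R | log_ultrametric G E}}.
have [e [eU eE]] := log_ultrametric_glue (inr true : U) (fun s : S => svalP s).
have [L [w [iota [J [ext wG wJ ind _]]]]] := exists_free_extension vG eU.
exists L, w, iota; split => //.
  apply/seteqP; split=> // _ [[g gG <-]|->]; last by exists 0; rewrite ?valuation0.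
  (* In the component where all distinct points have exponent [g], the difference of two of them has
     value [g]. *)
  pose s : S := exist _ _ (log_ultrametric_discrete U gG).
  exists (J (s, inr true) - J (s, inr false)) => //.
  by rewrite wJ eE/=; case: eqVneq.
move=> X Xu XG Xkappa.
have [d [dU dE]] := log_ultrametric_metric eta_gt1 Xu XG.
have [d' [dU' dE' d0']] := log_ultrametric_option dU.
have [j jinj] : exists j : X -> U, injective j.
  case: Xkappa => [X0|/card_leP[f]].
    by exists (fun=> inr true) => x; have : [set: X] x by []; rewrite X0.
  pose i (z : option X) : [set: option X] := SigSub (mem_set (I : setT z)).
  exists (fun x => inl (\val (f (i (Some x))))) => x y [/val_inj fxy].
  have : i (Some x) = i (Some y) by apply: 'inj_f; rewrite ?in_setE.
  by move=> /(congr1 val)[].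
(* [h] inverts [j] on its image and sends the rest of [U] to the added point [None]; pulling back
   along it extends the ultrametric of [X] to all of [U], which is then one of the glued
   components. *)
have /choice[h hP] : forall u : U, exists o : option X,
    if o is Some x then u = j x else forall x, u <> j x.
  move=> u; have [[x ux]|nu] := pselect (exists x, u = j x).
    by exists (Some x).
  by exists None => x ux; apply: nu; exists x.
have hj x : h (j x) = Some x.
  have := hP (j x); case: (h (j x)) => [y /jinj ->//|/(_ x)].
  by case.
have [|a b ab hab|E [EU hE]] := @log_ultrametric_pullback _ _ _ U _ None h dU'.
- by case.
- case E : (h a) => [x|]//; move: ab; have := hP a; have := hP b.
  by rewrite -hab E => -> ->; rewrite eqxx.
pose s : S := exist _ E EU.
exists (fun x => J (s, j x)); split.
  move=> x y; rewrite mdist_vmetric wJ eE dE -dE'.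
  by rewrite [sval _ _ _]hE ?hj.
by apply: algebraically_independent_sub ind => _ [x _ <-]; exists (s, j x).
Qed.

Lemma exists_closed_extension (R : realType) (eta : R) (eta_gt1 : 1 < eta)
    (G : zmodClosed R) (K : fieldType) (v : valuation R K) (X : metricType R) :
  range v `<=` adjoin_infty G ->
  ultrametric X ->
  metric_valued_in (expeN eta @` adjoin_infty G) X ->
  exists (F : fieldType) (u : valuation R F) (iota : {rmorphism K -> F})
         (I : X -> vmetric u eta_gt1),
    isometric_embedding I /\
    valued_extension v u iota /\
    range u `<=` adjoin_infty G /\
    closed (range I) /\
    algebraically_independent iota (range I) /\
    (complete_space X -> complete_space (vmetric u eta_gt1)).
Proof.
move=> vG Xu XG; have [d [dU dE]] := log_ultrametric_metric eta_gt1 Xu XG.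
have [F [u [iota [I [ext uG uI ind bI]]]]] := exists_free_extension vG dU.
(* The completion is used only for complete [X]: otherwise it could contain limits of points of the
   image outside the image. For other [X] the uncompleted field serves, with closedness coming from
   the bounded values. *)
have [cX|ncX] := pselect (complete_space X); last first.
  exists F, u, iota, I; split; first by move=> x y; rewrite mdist_vmetric uI dE.
  do 2!split => //; split; last by split.
  exact: (@bounded_closed _ _ eta_gt1 _ u _ I).
pose J : X -> vmetric (completion_valuation u) eta_gt1 := @completion_embed _ _ u \o I.
have Ji : isometric_embedding J.
  move=> x y; rewrite mdist_vmetric dE -uI; congr expeN.
  by rewrite -[RHS](completion_valuation_embed u) rmorphB.
exists (completion u), (completion_valuation u), (@completion_embed _ _ u \o iota), J.
split=> //; split.
  by move=> k; rewrite [LHS](completion_valuation_embed u) ext.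
split; first by apply: subset_trans uG; exact: completion_valuation_range.
split; first exact: isometric_complete_closed.
split; first exact: algebraically_independent_comp.
by move=> _; exact: completion_complete.
Qed.

Theorem theorem4p6 (R : realType) (eta : R) (eta_gt1 : 1 < eta)
  (q p : nat) (qpCH : CH q p) (kappa : Type)
  (G : zmodClosed R) (G1 : 1 \in G) (Gdiv : group_divisible G)
  (K : fieldType) (v : valuation R K)
  (Kchar : has_char K q)
  (vKG : range v `<=` adjoin_infty G)
  (kchar : has_char (residue_field v) p)
  (vp : q <> p -> v p%:R = 1%:E) :
  (exists (L : fieldType) (w : valuation R L) (iota : {rmorphism K -> L}),
    [/\ valued_extension v w iota,
        range w = adjoin_infty G
      & forall X : metricType R,
          ultrametric X ->
          metric_valued_in (expeN eta @` adjoin_infty G) X ->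
          [set: X] = set0 \/ [set: option X] #<= [set: kappa] ->
          exists I : X -> vmetric w eta_gt1,
            isometric_embedding I /\
            algebraically_independent iota (range I)])
  /\
  (forall X : metricType R,
    ultrametric X ->
    metric_valued_in (expeN eta @` adjoin_infty G) X ->
    exists (F : fieldType) (u : valuation R F) (iota : {rmorphism K -> F})
           (I : X -> vmetric u eta_gt1),
      isometric_embedding I /\
      valued_extension v u iota /\
      range u `<=` adjoin_infty G /\
      closed (range I) /\
      algebraically_independent iota (range I) /\
      (complete_space X -> complete_space (vmetric u eta_gt1))).
Proof.
split; first exact: exists_universal_extension.
by move=> X; exact: exists_closed_extension.
Qed.
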